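(* Let $Y_1,\ldots,Y_n$ be non-negative, integer-valued random variables which are negatively associated, and let $W=Y_1+\cdots+Y_n$ with $\sigma^2=\mathrm{Var}(W)$, $0<\sigma^2<\infty$. Then $$d_{\mathrm W}(\widetilde{W},\widetilde{Z})\leq \frac{\sum_{k=1}^n\mathbb{E}[Y_k^3]}{\sigma\sum_{k=1}^n\mathbb{E}[Y_k^2]}+\sqrt{\frac{8}{\pi}}\,\sigma^{-2}\left(-\sum_{i\not=j}\mathrm{Cov}(Y_i,Y_j)+\sum_{k=1}^n(\mathbb{E}[Y_k])^2\right),$$ where $\widetilde{W}=\sigma^{-1}(W-\mathbb{E}W)$ and $\widetilde{Z}\sim\mathrm{N}(0,1)$.
   Context: $Y_1,\ldots,Y_n$ are negatively associated if $$\mathbb{E}[g(Y_i,i\in\mathcal{I})\,h(Y_i,i\in\mathcal{J})]\leq\mathbb{E}[g(Y_i,i\in\mathcal{I})]\,\mathbb{E}[h(Y_i,i\in\mathcal{J})]$$ for all (coordinatewise) non-decreasing functions $g$ and $h$ (for which the expectations exist) and all disjoint sets $\mathcal{I},\mathcal{J}\subseteq\{1,\ldots,n\}$. The sum $\sum_{i\ne j}$ runs over all ordered pairs $(i,j)$ with $i,j\in\{1,\ldots,n\}$, $i\neq j$. Wasserstein distance: $d_{\mathrm W}(X,X')=\sup\{|\mathbb{E}h(X)-\mathbb{E}h(X')|: |h(x)-h(y)|\le|x-y| \text{ for all } x,y\in\mathbb{R}\}$. *)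

(* Defs.v *)
(* MathComp world, with MathComp-Analysis. *)
From HB Require Import structures.
From mathcomp Require Import all_boot all_order all_algebra.
From mathcomp Require Import all_classical all_reals all_analysis.

Set Implicit Arguments.
Unset Strict Implicit.
Unset Printing Implicit Defensive.

Import Order.TTheory GRing.Theory Num.Theory.
Import numFieldNormedType.Exports.

Local Open Scope classical_set_scope.
Local Open Scope ring_scope.

Definition coord_nondecreasing (K : finType) (R : realType)
    (g : (K -> R) -> R) : Prop :=
  forall x y : K -> R, (forall k, x k <= y k) -> g x <= g y.

(* "The expectations exist" is read as integrability, which includes the
   measurability of the composites: a coordinatewise monotone function of
   several real variables need not be Borel. *)
Definition negatively_associated (d : measure_display) (T : measurableType d)
    (R : realType) (P : probability T R) (n : nat) (Y : 'I_n -> T -> R) : Prop :=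
  forall (I J : {set 'I_n})
         (g : ({i : 'I_n | i \in I} -> R) -> R)
         (h : ({j : 'I_n | j \in J} -> R) -> R),
    [disjoint I & J]%B ->
    coord_nondecreasing g -> coord_nondecreasing h ->
    let gY t := g (fun i => Y (val i) t) in
    let hY t := h (fun j => Y (val j) t) in
    P.-integrable setT (EFin \o gY) ->
    P.-integrable setT (EFin \o hY) ->
    P.-integrable setT (EFin \o (fun t => gY t * hY t)) ->
    ('E_P[fun t => (gY t * hY t)%R] <= 'E_P[gY] * 'E_P[hY])%E.

(* The two variables may live on different probability spaces. The value is
   meaningful when both are integrable, every expectation then being finite. *)
Definition wasserstein (d d' : measure_display) (T : measurableType d)
    (T' : measurableType d') (R : realType) (P : probability T R)
    (P' : probability T' R) (X : T -> R) (X' : T' -> R) : \bar R :=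
  ereal_sup [set (`| 'E_P[h \o X] - 'E_P'[h \o X'] |)%E
            | h in [set h : R -> R | forall x y, `|h x - h y| <= `|x - y|]].

(* Main.v *)
Require Import Defs.
From HB Require Import structures.
From mathcomp Require Import all_boot all_order all_algebra.
From mathcomp Require Import all_classical all_reals all_analysis.
From mathcomp Require Import measurable_realfun.
From mathcomp Require Import ring lra.

Set Implicit Arguments.
Unset Strict Implicit.
Unset Printing Implicit Defensive.

Import Order.TTheory GRing.Theory Num.Theory.
Import numFieldNormedType.Exports.

Local Open Scope classical_set_scope.
Local Open Scope ring_scope.

(** The proof is by Stein's method.  For a 1-Lipschitz [h] let [f] solve
[f' x - x * f x = h x - E h(Z)].  Then [`|f'| <= sqrt (2 / pi)] ([steind_le])
and [f'] is 2-Lipschitz ([steind_lipschitz]), and one has to bound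
[E (f' (W~) - W~ * f (W~))].

Write [S2] and [S3] for the sums of the second and third moments, [mu] and
[sigma ^ 2] for the mean and variance of [W].  Expanding the variance shows
that [a := S2 - sigma ^ 2] is minus the sum of the covariances plus the sum of
the squared means, the quantity of the second term ([covariance_defectE]).  The
heart of the proof is the one-sided inequality
[E ((W - mu) * g W) <= S2 * E (g' W) + M / 2 * S3] for every nondecreasing [g]
whose derivative is M-Lipschitz ([mean_na_sum_le]).  If [`|g'| <= L], it applies
to [L * w + g w] and to [L * w - g w], and gives
[`|E ((W - mu) * g W) - S2 * E (g' W)| <= M / 2 * S3 + L * a]
([na_discrepancy_le]).  For [g w = f ((w - mu) / sigma)], dividing by [S2] gives
the first term of the theorem and half of the second; the other half pays for
replacing [sigma ^ 2] by [S2] in front of [E (g' W)] ([na_normal_approx]).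

The one-sided inequality is proved for one summand [Y] against the sum [V] of
the others ([mean_pair_le]).  Since [Y] is a natural number, [Y * g (Y + V)] is
the sum over [j < Y] of the increments [d_j V], where
[d_j v = (j + 1) * g (j + 1 + v) - j * g (j + v)].  These are not monotone in
[v], so negative association says nothing about them.  But [d_j v] is at most
[g w + ((j + 1) ^ 2 - j ^ 2) * g' w + M / 2 * ((j + 1) ^ 3 - j ^ 3)] for every
[w >= v] ([increment_le]), so the supremum of [d_j] over all arguments up to [v]
is a nondecreasing majorant of [d_j] with the same bound, in particular at
[w = Y + V].  Negative association decouples this supremum from the event
[j < Y], and summing over [j] rebuilds the moments of [Y].

The bounds on [f] use no derivative of [h]: at a point [x] the extremal [h] is
the distance to [x] for [f'], and a linear function for the derivative of
[x * f x].  The first case needs [(E `|Z - x|) ^ 2] to be at most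
[x ^ 2 + 4 * phi x * phi 0] ([excess_mul_le]).  The inequalities between normal
tails all come from functions that decrease to 0. *)

(** * Monotone functions and differentiation *)

Section calculus.
Context {R : realType}.
Implicit Types (f g : R -> R) (x y a b c : R).

Lemma is_derive1_eq f x a b : is_derive x 1 f a -> a = b -> is_derive x 1 f b.
Proof. by move=> fa <-. Qed.

Lemma is_derive1_id x : is_derive x 1 (fun y => y : R) (1 : R).
Proof. exact: is_derive_id. Qed.

Lemma is_derive1V f x a : f x != 0 -> is_derive x 1 f a ->
  is_derive x 1 (fun y => (f y)^-1) (- a / f x ^+ 2).
Proof.
move=> fx0 fa; have := is_deriveV fx0 fa => /is_derive1_eq; apply.
by rewrite /GRing.scale/= mulrC mulrN mulNr.
Qed.

Lemma is_derive1_MVT f (df : R -> R) a b : a <= b ->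
  (forall x, a <= x <= b -> is_derive x 1 f (df x)) ->
  a = b \/ exists2 c, a < c < b & f b - f a = df c * (b - a).
Proof.
rewrite le_eqVlt => /predU1P[->|ab fdf]; [by left|right].
have [||c] := @MVT R f df a b ab; last by rewrite in_itv/= => ?; exists c.
- move=> x; rewrite in_itv/= => /andP[/ltW ax /ltW xb].
  by apply: fdf; rewrite ax.
- apply: derivable_within_continuous => x; rewrite in_itv/= => /fdf fx.
  exact: ex_derive.
Qed.

Lemma is_derive1_le0 f (df : R -> R) a b : a <= b ->
  (forall x, a <= x <= b -> is_derive x 1 f (df x)) ->
  (forall x, a < x < b -> df x <= 0) -> f b <= f a.
Proof.
move=> ab fdf df0; have [->//|[c acb fE]] := is_derive1_MVT ab fdf.
by rewrite -subr_le0 fE mulr_le0_ge0 ?df0// subr_ge0.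
Qed.

Lemma is_derive1_lipschitz f (df : R -> R) c :
  (forall x, is_derive x 1 f (df x)) -> (forall x, `|df x| <= c) ->
  forall x y, `|f x - f y| <= c * `|x - y|.
Proof.
move=> fdf dfc x y; wlog yx : x y / y <= x.
  move=> hw; have [/hw//|/ltW xy] := leP y x.
  by rewrite distrC [`|x - y|]distrC; exact: hw.
have [->|[z _ ->]] := is_derive1_MVT yx (fun z _ => fdf z).
  by rewrite !subrr normr0 mulr0.
by rewrite normrM ler_wpM2r.
Qed.

(** A nonincreasing function that is eventually bounded below by a null
sequence is nonnegative.  This is how the tail inequalities for the normal
law are obtained: each defect decreases to a limit that is visibly
nonnegative. *)
Lemma nincr_vanishing_ge0 f (df : R -> R) (u : nat -> R) a :
  (forall x, a <= x -> is_derive x 1 f (df x)) ->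
  (forall x, a < x -> df x <= 0) ->
  u @ \oo --> 0 -> (forall n, a <= n.+1%:R -> u n <= f n.+1%:R) -> 0 <= f a.
Proof.
move=> fdf df0 u0 uf; rewrite leNgt; apply/negP => fa0.
near \oo => n.
have an : a <= n.+1%:R.
  rewrite ltW// (@lt_le_trans _ _ n%:R) ?ler_nat//.
  by near: n; exact: nbhs_infty_gtr.
have : f n.+1%:R <= f a.
  by apply: (is_derive1_le0 an) => x /andP[ax _]; [exact: fdf|exact: df0].
rewrite leNgt => /negP; apply; rewrite (lt_le_trans _ (uf n an))//.
by near: n; apply: (cvgr_gt 0) => //.
Unshelve. all: by end_near. Qed.

Lemma ndecr_vanishing_ge0 f (df : R -> R) (u : nat -> R) a :
  (forall x, x <= a -> is_derive x 1 f (df x)) ->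
  (forall x, x < a -> 0 <= df x) ->
  u @ \oo --> 0 ->
  (forall n, - n.+1%:R <= a -> u n <= f (- n.+1%:R)) -> 0 <= f a.
Proof.
move=> fdf df0 u0 uf; rewrite -[a]opprK.
apply: (@nincr_vanishing_ge0 (fun x => f (- x)) (fun x => - df (- x)) u) => //.
- move=> x ax.
  apply: (@is_derive1_eq _ _ (df (- x) * - 1)); last by rewrite mulrN1.
  by apply: (@is_derive1_comp _ f -%R) => //; apply: fdf; rewrite lerNl.
- by move=> x ax; rewrite oppr_le0; apply: df0; rewrite ltrNl.
- by move=> n an; apply: uf; rewrite lerNl.
Qed.

Lemma lipschitz_ge0 f c :
  (forall x y, `|f x - f y| <= c * `|x - y|) -> 0 <= c.
Proof.
move=> lip; have := le_trans (normr_ge0 _) (lip 1 0).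
by rewrite subr0 normr1 mulr1.
Qed.

Lemma lipschitz_continuous f c :
  (forall x y, `|f x - f y| <= c * `|x - y|) -> continuous f.
Proof.
move=> lip x; have c0 := lipschitz_ge0 lip.
apply/cvgrPdist_le => e e0; near=> y.
rewrite (le_trans (lip _ _))// (@le_trans _ _ ((c + 1) * `|x - y|))//.
  by rewrite ler_wpM2r// lerDl.
rewrite mulrC -ler_pdivlMr ?ltr_wpDl//.
by near: y; apply: cvgr_dist_le => //; rewrite divr_gt0// ltr_wpDl.
Unshelve. all: by end_near. Qed.

Lemma lipschitz_growth f c : (forall x y, `|f x - f y| <= c * `|x - y|) ->
  forall x, `|f x| <= `|f 0| + c * `|x|.
Proof.
move=> lip x; have := ler_normD (f x - f 0) (f 0); rewrite subrK => fx.
by have := lip x 0; rewrite subr0; lra.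
Qed.

End calculus.

(** * Primitives from minus infinity *)

Section primitive.
Context {R : realType}.
Notation mu := (@lebesgue_measure R).
Variable g : R -> R.
Hypothesis intg : mu.-integrable setT (EFin \o g).

Definition primitiveNy (x : R) : R := \int[mu]_(t in `]-oo, x]) g t.

Lemma is_derive_primitiveNy x : {for x, continuous g} ->
  is_derive x 1 primitiveNy (g x).
Proof.
move=> gx; have [|||dG GE] := @continuous_FTC1 R g -oo%O x (x + 1) _ _ _ gx.
- by rewrite ltrDl.
- exact: integrableS intg.
- by rewrite ltNyr.
- by split; [exact: dG|rewrite -derive1E GE].
Qed.

Let cvg_primitive (a : nat -> R) (l : R -> R) :
  (forall t, \forall n \near \oo, g t * (t <= a n)%R%:R = l t) ->
  primitiveNy (a n) @[n --> \oo] --> \int[mu]_t l t.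
Proof.
move=> al.
have mg : measurable_fun setT g by case/integrableP: intg => /measurable_EFinP.
have mga n : measurable_fun setT (fun t => g t * (t <= a n)%R%:R).
  rewrite [X in measurable_fun _ X](_ : _ = g \* \1_`]-oo, a n]).
    by apply: measurable_funM => //; exact: measurable_indic.
  by apply/funext => t; rewrite /= indicE mem_setE in_itv.
have cvl t : (g t * (t <= a n)%R%:R)%:E @[n --> \oo] --> (l t)%:E.
  by apply: cvg_near_cst; near do congr EFin; exact: al.
have [] := @dominated_convergence _ _ _ mu setT measurableT
    (fun n t => (g t * (t <= a n)%R%:R)%:E) (EFin \o l) (abse \o (EFin \o g)).
- by move=> n; apply/measurable_EFinP; exact: mga.
- apply: (emeasurable_fun_cvg (fun n t => (g t * (t <= a n)%R%:R)%:E)) => //.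
  by move=> n; apply/measurable_EFinP; exact: mga.
- by apply: aeW => t _; exact: cvl.
- exact: integrable_abse.
- apply: aeW => t n _; rewrite /= lee_fin normrM ler_piMr//.
  by rewrite normr_nat lern1 leq_b1.
- move=> il _ /=; set J := (X in X @ \oo --> _) => cJ.
  have JE : J = (fun n => (primitiveNy (a n))%:E).
    apply/funext => n; rewrite /primitiveNy /Rintegral fineK; last first.
      by apply: integrable_fin_num => //; exact: integrableS intg.
    rewrite /J integral_mkcond; apply: eq_integral => t _; rewrite patchE.
    by rewrite mem_setE in_itv/=; case: ifPn => _; rewrite ?mulr1 ?mulr0.
  rewrite /Rintegral; move: cJ.
  rewrite -[X in _ --> X]fineK; last exact: integrable_fin_num.
  by rewrite JE => /fine_cvg.
Unshelve. all: by end_near. Qed.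

Let near_nat_ge t : \forall n \near \oo, t <= n.+1%:R :> R.
Proof.
near=> n; rewrite ltW// (@lt_le_trans _ _ n%:R) ?ler_nat//.
by near: n; exact: nbhs_infty_gtr.
Unshelve. all: by end_near. Qed.

Lemma cvg_primitiveNy : primitiveNy n.+1%:R @[n --> \oo] --> \int[mu]_t g t.
Proof.
apply: (cvg_primitive (a := fun n => n.+1%:R)) => t; near=> n.
suff -> : t <= n.+1%:R by rewrite mulr1.
by near: n; exact: near_nat_ge.
Unshelve. all: by end_near. Qed.

Lemma cvg_primitiveNyNy : primitiveNy (- n.+1%:R) @[n --> \oo] --> 0.
Proof.
have <- : \int[mu]_t (fun=> 0) t = 0 by rewrite Rintegral_cst ?mul0r.
apply: (cvg_primitive (a := fun n => - n.+1%:R)) => t; near=> n.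
suff tn : - (t - 1) <= n.+1%:R.
  by rewrite leNgt (_ : - n.+1%:R < t) ?mulr0//; lra.
by near: n; exact: near_nat_ge.
Unshelve. all: by end_near. Qed.

End primitive.

(** * The standard normal law *)

Section gauss.
Context {R : realType}.
Notation mu := (@lebesgue_measure R).
Implicit Types x y : R.

Definition phi : R -> R := normal_pdf 0 1.
Definition Phi : R -> R := primitiveNy phi.
Definition Psi x : R := 1 - Phi x.

Lemma phiE x : phi x = normal_peak 1 * expR (- (x ^+ 2 / 2)).
Proof.
by rewrite /phi normal_pdfE ?oner_eq0// /normal_fun subr0 expr1n mulNr.
Qed.

Lemma phi0E : phi 0 = normal_peak 1.
Proof. by rewrite phiE expr0n/= mul0r oppr0 expR0 mulr1. Qed.

Lemma phi0_sqrtE : 2 * phi 0 = Num.sqrt (2 / pi).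
Proof.
rewrite phi0E /normal_peak; move: (pi_gt0 R); move: pi => p p0.
apply/eqP; rewrite -(@eqrXn2 _ 2) ?sqrtr_ge0// ?mulr_ge0 ?invr_ge0 ?sqrtr_ge0//.
rewrite sqr_sqrtr ?divr_ge0 ?(ltW p0)// exprMn exprVn.
rewrite sqr_sqrtr ?expr1n ?mul1r ?mulrn_wge0 ?(ltW p0)// -mulr_natr.
by apply/eqP; field; rewrite gt_eqF.
Qed.

Lemma phi_gt0 x : 0 < phi x.
Proof. by rewrite phiE mulr_gt0 ?expR_gt0// normal_peak_gt0// oner_eq0. Qed.

Lemma phi_le x : phi x <= phi 0.
Proof. by rewrite phi0E; apply: normal_pdf_ub; rewrite oner_eq0. Qed.

Lemma phiN x : phi (- x) = phi x.
Proof. by rewrite !phiE sqrrN. Qed.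

Global Instance is_derive_phi x : is_derive x 1 phi (- (x * phi x)).
Proof.
have -> : phi = fun y => normal_peak 1 * expR (- (y * y * 2^-1)).
  by apply/funext => y; rewrite phiE.
by apply: is_derive1_eq; rewrite /GRing.scale/=; field.
Qed.

Lemma continuous_phi : continuous phi.
Proof. by apply: continuous_normal_pdf; rewrite oner_eq0. Qed.

Lemma integrable_phi : mu.-integrable setT (EFin \o phi).
Proof. exact: integrable_normal_pdf. Qed.

Lemma Rintegral_phi : \int[mu]_x phi x = 1.
Proof. by rewrite /Rintegral integral_normal_pdf. Qed.

Global Instance is_derive_Phi x : is_derive x 1 Phi (phi x).
Proof.
apply: is_derive_primitiveNy; first exact: integrable_phi.
exact: continuous_phi.
Qed.

Global Instance is_derive_Psi x : is_derive x 1 Psi (- phi x).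
Proof.
by apply: is_derive1_eq; rewrite /GRing.scale/=; ring.
Qed.

Lemma cvg_Psi : Psi n.+1%:R @[n --> \oo] --> 0.
Proof.
rewrite -[X in _ --> X](subrr 1) -[in X in _ --> X]Rintegral_phi.
apply: cvgB; first by rewrite Rintegral_phi; exact: cvg_cst.
exact/cvg_primitiveNy/integrable_phi.
Qed.

(** The square of [1 + u <= expR u] at [u = x ^+ 2 / 4].  This much decay is
enough for all the tail inequalities below. *)
Lemma phi_decay (n : nat) : n.+1%:R ^+ 2 * phi n.+1%:R <= 16 * phi 0 / n.+1%:R.
Proof.
rewrite phiE phi0E; set p := normal_peak 1; set x : R := n.+1%:R.
have p0 : 0 < p by rewrite normal_peak_gt0// oner_eq0.
have x1 : 1 <= x by rewrite ler1n.
have x0 : 0 < x by lra.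
have e4 : (x ^+ 2 / 4) ^+ 2 <= expR (x ^+ 2 / 2).
  have -> : x ^+ 2 / 2 = x ^+ 2 / 4 + x ^+ 2 / 4 by field.
  rewrite expRD -expr2 ler_sqr ?nnegrE ?expR_ge0 ?divr_ge0 ?sqr_ge0//.
  by have := expR_ge1Dx (x ^+ 2 / 4); lra.
have x2 : x ^+ 2 <= x ^+ 3 by rewrite ler_weXn2l.
rewrite expRN mulrA ler_pdivrMr ?expR_gt0// [leRHS]mulrAC ler_pdivlMr//.
apply: (@le_trans _ _ (16 * p * (x ^+ 2 / 4) ^+ 2)).
  have -> : 16 * p * (x ^+ 2 / 4) ^+ 2 = x ^+ 4 * p by field.
  by rewrite mulrAC -exprSr ler_pM2r// ler_weXn2l.
by rewrite ler_pM2l// mulr_gt0.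
Qed.

Let cvg_bound : 16 * phi 0 / n.+1%:R @[n --> \oo] --> (0 : R).
Proof.
rewrite -[X in _ --> X](mulr0 (16 * phi 0)).
by apply: cvgMr; exact: cvg_harmonic.
Qed.

Let cvg_decay : - (16 * phi 0 / n.+1%:R) @[n --> \oo] --> (0 : R).
Proof. by rewrite -[X in _ --> X]oppr0; exact: cvgN cvg_bound. Qed.

Lemma cvg_phi : phi n.+1%:R @[n --> \oo] --> (0 : R).
Proof.
apply: (squeeze_cvgr _ (cvg_cst 0) cvg_bound).
near=> n; rewrite ltW ?phi_gt0//= (le_trans _ (phi_decay n))//.
by rewrite ler_peMl ?(ltW (phi_gt0 _))// exprn_ege1// ler1n.
Unshelve. all: by end_near. Qed.

Lemma Psi_ge0 x : 0 <= Psi x.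
Proof.
apply: (nincr_vanishing_ge0 (f := Psi) (df := fun y => - phi y)
  (u := fun n => Psi n.+1%:R)) => //.
  by move=> y _; rewrite oppr_le0 ltW// phi_gt0.
exact: cvg_Psi.
Qed.

Lemma Psi_le_phi x : 1 <= x -> Psi x <= phi x.
Proof.
move=> x1; rewrite -subr_ge0.
apply: (nincr_vanishing_ge0 (f := fun y => phi y - Psi y)
  (df := fun y => - (y * phi y) + phi y) (u := fun n => - Psi n.+1%:R)).
- by move=> y _; apply: is_derive1_eq; ring.
- by move=> y xy; have := phi_gt0 y; nra.
- by rewrite -[X in _ --> X]oppr0; apply: cvgN; exact: cvg_Psi.
- by move=> n _; rewrite lerDr ltW// phi_gt0.
Qed.

(** This is [E (Z - x)^+] for [Z] standard normal.  That it is nonnegative is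
Mills' bound on [Psi]. *)
Definition excess x : R := phi x - x * Psi x.

Global Instance is_derive_excess x : is_derive x 1 excess (- Psi x).
Proof. by apply: is_derive1_eq; rewrite /GRing.scale/=; ring. Qed.

Let phi_le_decay (n : nat) : n.+1%:R * phi n.+1%:R <= 16 * phi 0 / n.+1%:R.
Proof.
apply: le_trans (phi_decay n).
by rewrite ler_pM2r ?phi_gt0// expr2 ler_peMr// ler1n.
Qed.

Lemma excess_ge0 x : 0 <= excess x.
Proof.
apply: (nincr_vanishing_ge0 (f := excess) (df := fun y => - Psi y)
  (fun y _ => is_derive_excess y) _ cvg_decay).
- by move=> y _; rewrite oppr_le0 Psi_ge0.
- move=> n _; rewrite /excess.
  have n1 : 1 <= n.+1%:R :> R by rewrite ler1n.
  apply: (@le_trans _ _ (- (n.+1%:R * phi n.+1%:R))); first by rewrite lerN2.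
  have := ler_wpM2l (ler0n R n.+1) (Psi_le_phi n1).
  by have := phi_gt0 (n.+1%:R : R); lra.
Qed.

(** This is [E ((Z - x)^+) ^ 2]. *)
Definition excess2 x : R := Psi x - x * excess x.

Global Instance is_derive_excess2 x : is_derive x 1 excess2 (- (2 * excess x)).
Proof. by apply: is_derive1_eq; rewrite /GRing.scale/= /excess; ring. Qed.

Lemma excess2_ge0 x : 0 <= excess2 x.
Proof.
apply: (nincr_vanishing_ge0 (f := excess2) (df := fun y => - (2 * excess y))
  (fun y _ => is_derive_excess2 y) _ cvg_decay).
- by move=> y _; rewrite oppr_le0 mulr_ge0// excess_ge0.
- move=> n _; rewrite /excess2 /excess.
  apply: (@le_trans _ _ (- (n.+1%:R * phi n.+1%:R))); first by rewrite lerN2.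
  rewrite mulrBr mulrA -expr2.
  have := mulr_ge0 (sqr_ge0 (n.+1%:R : R)) (Psi_ge0 n.+1%:R).
  by have := Psi_ge0 (n.+1%:R : R); lra.
Qed.

(** Both sides have the same derivative and the same limit at infinity. *)
Lemma Phi_reflect x : Phi (- x) = Psi x.
Proof.
pose F (s : R) y := s * (Psi y - Phi (- y)).
have FK s : 0 <= F s x.
  apply: (nincr_vanishing_ge0 (f := F s) (df := fun=> 0)
    (u := fun n => F s n.+1%:R)) => //.
  - move=> y _.
    have dPhi : is_derive y 1 (fun y => Phi (- y)) (- phi y).
      have H : is_derive y 1 (Phi \o -%R) (phi (- y) * - 1).
        exact: is_derive1_comp.
      by apply: (is_derive1_eq H); rewrite phiN mulrN1.
    rewrite /F; apply: is_derive1_eq; rewrite /GRing.scale/=; ring.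
  - rewrite /F -[X in _ --> X](mulr0 s) -[X in _ --> s * X](subr0 0).
    apply: cvgMr; apply: cvgB; first exact: cvg_Psi.
    exact/cvg_primitiveNyNy/integrable_phi.
by have := FK 1; have := FK (- 1); rewrite /F; lra.
Qed.

Lemma Psi_reflect x : Psi (- x) = Phi x.
Proof. by rewrite -Phi_reflect opprK. Qed.

Lemma excessN x : excess (- x) = phi x + x * Phi x.
Proof. by rewrite /excess phiN Psi_reflect; ring. Qed.

Lemma Phi0 : Phi 0 = 2^-1.
Proof. by have := Phi_reflect 0; rewrite oppr0 /Psi; lra. Qed.

End gauss.

(** * The mean absolute deviation of a normal variable from a point *)

Section gini.
Context {R : realType}.
Implicit Types x y : R.

Let Psi0 : Psi 0 = 2^-1 :> R.
Proof. by rewrite -Phi_reflect oppr0 Phi0. Qed.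

Let central_ge x : 0 <= x -> x * phi x <= 1 - 2 * Psi x.
Proof.
move=> x0; pose F y : R := y * phi y + 2 * Psi y.
have : F x <= F 0.
  apply: (is_derive1_le0 (df := fun y => - ((1 + y ^+ 2) * phi y)) x0).
  - by move=> y _; apply: is_derive1_eq; rewrite /GRing.scale/=; ring.
  - by move=> y _; rewrite oppr_le0 mulr_ge0 ?addr_ge0 ?sqr_ge0// ltW// phi_gt0.
by rewrite /F Psi0; lra.
Qed.

Let central_le x : 0 <= x -> (1 - 2 * Psi x) * (2 - x ^+ 2) <= 4 * x * phi x.
Proof.
move=> x0; pose F y : R := (1 - 2 * Psi y) * (2 - y * y) - 4 * y * phi y.
have : F x <= F 0.
  apply: (is_derive1_le0
    (df := fun y => - (2 * y * (1 - 2 * Psi y - y * phi y))) x0).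
  - by move=> y _; apply: is_derive1_eq; rewrite /GRing.scale/=; ring.
  - move=> y /andP[/ltW y0 _]; rewrite oppr_le0 mulr_ge0 ?mulr_ge0//.
    by rewrite subr_ge0 central_ge.
by rewrite /F Psi0 expr2; lra.
Qed.

Let den_gt0 x : 0 < x -> 0 < x * (2 + x ^+ 2).
Proof. by move=> x0; rewrite mulr_gt0// ltr_wpDr// sqr_ge0. Qed.

(* The difference of the two sides decreases to 0, by central_le; up to the
positive factor x * (2 + x ^+ 2) / phi x, it is the opposite of the derivative
of the left side of excess_mul_le divided by phi x. *)
Let tails_mul_ge x : 0 < x ->
  phi x * ((1 + x ^+ 2) * (1 - 2 * Psi x) + x * phi x) / (x * (2 + x ^+ 2)) <=
  Psi x * (1 - Psi x).
Proof.
move=> x0; rewrite -subr_ge0.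
pose F y : R := Psi y * (1 - Psi y) -
  phi y * ((1 + y * y) * (1 - 2 * Psi y) + y * phi y) / (y * (2 + y * y)).
have -> : Psi x * (1 - Psi x) - phi x * ((1 + x ^+ 2) * (1 - 2 * Psi x)
    + x * phi x) / (x * (2 + x ^+ 2)) = F x by rewrite /F !expr2.
apply: (nincr_vanishing_ge0 (f := F)
  (df := fun y => - (phi y * (4 * y * phi y - (1 - 2 * Psi y) * (2 - y ^+ 2))
                     / (y * (2 + y ^+ 2)) ^+ 2))
  (u := fun n => - ((1 + phi 0) * phi n.+1%:R))).
- move=> y xy.
  have y0 : 0 < y by exact: lt_le_trans xy.
  have dV := is_derive1V (f := fun y => y * (2 + y * y)).
  have y2 : y * (2 + y * y) != 0 by rewrite gt_eqF// -expr2 den_gt0.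
  have dD : is_derive y 1 (fun y => y * (2 + y * y)) (2 + 3 * (y * y)).
    by apply: is_derive1_eq; rewrite /GRing.scale/=; ring.
  have {}dV := dV y _ y2 dD.
  apply: is_derive1_eq; rewrite /GRing.scale/=.
  by field; rewrite !lt0r_neq0// ltr_wpDr ?sqr_ge0.
- move=> y xy; have y0 : 0 < y by exact: lt_trans xy.
  rewrite oppr_le0 divr_ge0 ?sqr_ge0// mulr_ge0 ?(ltW (phi_gt0 _))//.
  by rewrite subr_ge0 central_le// ltW.
- rewrite -[X in _ --> X]oppr0 -[X in _ --> - X](mulr0 (1 + phi 0)).
  by apply: cvgN; apply: cvgMr; exact: cvg_phi.
- move=> n _; rewrite /F; set y : R := n.+1%:R.
  have y1 : 1 <= y by rewrite ler1n.
  have y0 : 0 < y by lra.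
  have Py := Psi_ge0 y; have Py1 : Psi y <= 1.
    by have := central_ge (ltW y0); have := mulr_gt0 y0 (phi_gt0 y); lra.
  have D0 : 0 < y * (2 + y * y) by rewrite -expr2 den_gt0.
  apply: (@le_trans _ _ (0 - (1 + phi 0) * phi y)); first by rewrite sub0r.
  apply: lerB; first by rewrite mulr_ge0// subr_ge0.
  have le1 : (1 + y * y) * (1 - 2 * Psi y) + y * phi y <=
             (1 + phi 0) * (y * (2 + y * y)).
    rewrite [leRHS]mulrDl mul1r; apply: lerD; first by nra.
    rewrite mulrC; apply: ler_pM => //; last by nra.
    - exact: ltW (phi_gt0 _).
    - exact: phi_le.
  rewrite ler_pdivrMr// [leRHS]mulrAC [leRHS]mulrC.
  by rewrite ler_pM2l ?phi_gt0.
Qed.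

(** This is [(E `|Z - x|) ^ 2 <= x ^ 2 + 4 * phi x * phi 0], since
[E `|Z - x| = excess x + excess (- x)].  There is equality at [0], and
the left side divided by [phi x] decreases on the nonnegative half-line. *)
Lemma excess_mul_le x : excess x * excess (- x) <= phi x * phi 0.
Proof.
wlog x0 : x / 0 <= x.
  move=> hw; have [/hw//|/ltW x0] := leP 0 x.
  by have := hw (- x); rewrite opprK phiN mulrC; apply; rewrite oppr_ge0.
pose K y : R := excess y * (phi y + y * (1 - Psi y)) * (phi y)^-1.
have PhiE y : Phi y = 1 - Psi y :> R by rewrite /Psi; ring.
rewrite -ler_pdivrMl ?phi_gt0// mulrC excessN PhiE -/(K x).
have <- : K 0 = phi 0.
  by rewrite /K /excess !mul0r subr0 addr0 mulfK// gt_eqF// phi_gt0.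
pose N y : R := phi y * ((1 + y ^+ 2) * (1 - 2 * Psi y) + y * phi y)
  - y * (2 + y ^+ 2) * (Psi y * (1 - Psi y)).
apply: (is_derive1_le0 (df := fun y => N y / phi y) x0).
- move=> y _; have p0 : phi y != 0 by rewrite gt_eqF// phi_gt0.
  have dV := is_derive1V p0 (is_derive_phi y).
  apply: is_derive1_eq; rewrite /GRing.scale/= /N /excess.
  by field.
- move=> y /andP[y0 _].
  rewrite pmulr_lle0 ?invr_gt0 ?phi_gt0// subr_le0.
  by have := tails_mul_ge y0; rewrite ler_pdivrMr ?den_gt0// [leRHS]mulrC.
Qed.

End gini.

(** * Stein's equation for Lipschitz test functions *)

Section stein.
Context {R : realType}.
Notation mu := (@lebesgue_measure R).
Variable h : R -> R.
Hypothesis lip_h : forall x y, `|h x - h y| <= `|x - y|.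

Let hphi x : R := h x * phi x.

Let continuous_hphi : continuous hphi.
Proof.
move=> x; apply: cvgM; last exact: continuous_phi.
by apply: (@lipschitz_continuous _ h 1) => a b; rewrite mul1r.
Qed.

(* The wider normal density absorbs the linear growth of h. *)
Lemma integrable_lipschitz_phi : mu.-integrable setT (EFin \o hphi).
Proof.
pose C : R := (`|h 0| + 2) * phi 0 / normal_peak 2.
have p2 : 0 < normal_peak 2 :> R by rewrite normal_peak_gt0// pnatr_eq0.
apply: (@le_integrable _ _ _ mu setT measurableT _
  (fun x => (C * normal_pdf 0 2 x)%:E)).
- by apply/measurable_EFinP; exact: continuous_measurable_fun continuous_hphi.
- move=> x _ /=; rewrite lee_fin.
  rewrite normal_pdfE ?pnatr_eq0// /normal_fun subr0 /C.
  rewrite normrM (ger0_norm (ltW (phi_gt0 _))) phiE -phi0E.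
  set e := expR (- (x ^+ 2) / _); have e0 : 0 < e by exact: expR_gt0.
  rewrite [leRHS]ger0_norm; last first.
    rewrite mulr_ge0 ?divr_ge0 ?mulr_ge0 ?addr_ge0 ?(ltW p2) ?(ltW e0)//.
    exact: ltW (phi_gt0 _).
  have -> : (`|h 0| + 2) * phi 0 / normal_peak 2 * (normal_peak 2 * e) =
    (`|h 0| + 2) * e * phi 0 by field; rewrite gt_eqF.
  rewrite mulrCA mulrC ler_pM2r ?phi_gt0//.
  have hx : `|h x| <= `|h 0| + `|x|.
    have := lip_h x 0; have := ler_normB (h x - h 0) (- h 0).
    by rewrite subr0 opprK subrK normrN; lra.
  have -> : expR (- (x ^+ 2 / 2)) = e * expR (- (3 / 8 * x ^+ 2)).
    by rewrite -expRD; congr expR; field.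
  rewrite mulrCA [leRHS]mulrC ler_pM2l// expRN ler_pdivrMr ?expR_gt0//.
  have := expR_ge1Dx (3 / 8 * x ^+ 2); set E := expR _ => hE.
  have x2 : x ^+ 2 = `|x| ^+ 2 by rewrite real_normK ?num_real.
  have a0 : 0 <= `|h 0| + 2 by rewrite addr_ge0.
  apply: le_trans (ler_wpM2l a0 hE); apply: le_trans hx _; rewrite x2.
  have := mulr_ge0 (normr_ge0 (h 0)) (sqr_ge0 `|x|).
  by have := sqr_ge0 (`|x| - 2 / 3); lra.
- under eq_fun do rewrite EFinM.
  by apply: integrableZl => //; exact: integrable_normal_pdf.
Qed.


Definition normal_mean : R := \int[mu]_x hphi x.

Let H : R -> R := primitiveNy hphi.

Let is_derive_H (x : R) : is_derive x 1 H (h x * phi x).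
Proof.
apply: is_derive_primitiveNy; first exact: integrable_lipschitz_phi.
exact: continuous_hphi.
Qed.

(** The solution of [f' x = x * f x + (h x - normal_mean)] that stays bounded
at both ends of the line. *)
Definition stein x : R := (H x - Phi x * normal_mean) / phi x.

Definition steind x : R := x * stein x + (h x - normal_mean).

Lemma is_derive_stein (x : R) : is_derive x 1 stein (steind x).
Proof.
have p0 : phi x != 0 by rewrite gt_eqF// phi_gt0.
have dV := is_derive1V p0 (is_derive_phi x).
have dH := is_derive_H x.
apply: is_derive1_eq; rewrite /GRing.scale/= /steind /stein.
by field.
Qed.

(* The contributions of h - h x to the normal mean from both sides of x.  Each
is bounded by its value when h is the distance to x, which is an excess. *)
Let lower x : R := H x - h x * Phi x.
Let upper x : R := normal_mean - H x - h x * Psi x.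

Let steinE x : stein x = (Psi x * lower x - Phi x * upper x) / phi x.
Proof. by rewrite /stein /lower /upper /Psi; congr (_ / _); ring. Qed.

Let steindE x :
  steind x = - (excess x * lower x + excess (- x) * upper x) / phi x.
Proof.
rewrite /steind steinE excessN /excess /lower /upper /Psi.
by field; rewrite gt_eqF// phi_gt0.
Qed.

Let lower_le x : `|lower x| <= excess (- x).
Proof.
rewrite excessN.
have bnd s : `|s| <= 1 -> s * lower x <= phi x + x * Phi x.
  move=> s1; rewrite -subr_ge0.
  pose F y : R := phi y + x * Phi y - s * (H y - h x * Phi y).
  apply: (ndecr_vanishing_ge0 (f := F)
    (df := fun y => phi y * ((x - y) - s * (h y - h x)))
    (u := fun n => F (- n.+1%:R)) _ _ _ (fun n _ => lexx _)).
  - move=> y _; have dH := is_derive_H y.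
    by rewrite /F; apply: is_derive1_eq; rewrite /GRing.scale/=; ring.
  - move=> y yx; rewrite mulr_ge0 ?(ltW (phi_gt0 _))// subr_ge0.
    rewrite (le_trans (ler_norm _))// normrM.
    have -> : x - y = `|y - x| by rewrite distrC gtr0_norm// subr_gt0.
    by rewrite -[leRHS]mul1r ler_pM.
  - have -> : 0 = 0 + x * 0 - s * (0 - h x * 0) :> R by ring.
    have cP : Phi (- n.+1%:R) @[n --> \oo] --> (0 : R).
      exact/cvg_primitiveNyNy/integrable_phi.
    have cH : H (- n.+1%:R) @[n --> \oo] --> (0 : R).
      exact/cvg_primitiveNyNy/integrable_lipschitz_phi.
    have cp : phi (- n.+1%:R) @[n --> \oo] --> (0 : R).
      by under eq_fun do rewrite phiN; exact: cvg_phi.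
    apply: cvgB; first by apply: cvgD => //; exact: cvgMr.
    by apply: cvgMr; apply: cvgB => //; exact: cvgMr.
rewrite ler_norml lerNl -mulN1r -[X in _ && (X <= _)]mul1r.
by rewrite !bnd ?normrN1 ?normr1.
Qed.

Let upper_le x : `|upper x| <= excess x.
Proof.
have bnd s : `|s| <= 1 -> s * upper x <= phi x - x * Psi x.
  move=> s1; rewrite -subr_ge0.
  pose F y : R := phi y - x * Psi y - s * (normal_mean - H y - h x * Psi y).
  apply: (nincr_vanishing_ge0 (f := F)
    (df := fun y => phi y * ((x - y) + s * (h y - h x)))
    (u := fun n => F n.+1%:R) _ _ _ (fun n _ => lexx _)).
  - move=> y _; have dH := is_derive_H y.
    by rewrite /F; apply: is_derive1_eq; rewrite /GRing.scale/=; ring.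
  - move=> y xy; rewrite pmulr_rle0 ?phi_gt0// addrC -lerBrDr sub0r opprB.
    rewrite (le_trans (ler_norm _))// normrM.
    have -> : y - x = `|y - x| by rewrite gtr0_norm// subr_gt0.
    by rewrite -[leRHS]mul1r ler_pM.
  - have -> : 0 = 0 - x * 0 - s * (normal_mean - normal_mean - h x * 0) :> R.
      by ring.
    have cP : Psi n.+1%:R @[n --> \oo] --> (0 : R) by exact: cvg_Psi.
    have cH : H n.+1%:R @[n --> \oo] --> normal_mean.
      exact/cvg_primitiveNy/integrable_lipschitz_phi.
    have cp : phi n.+1%:R @[n --> \oo] --> (0 : R) by exact: cvg_phi.
    apply: cvgB; first by apply: cvgB => //; exact: cvgMr.
    apply: cvgMr; apply: cvgB; last exact: cvgMr.
    by apply: cvgB => //; exact: cvg_cst.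
rewrite ler_norml lerNl -mulN1r -[X in _ && (X <= _)]mul1r.
by rewrite !bnd ?normrN1 ?normr1.
Qed.

(** Written in [lower] and [upper], the derivative is largest for
[h z = - `|z - x|], where [excess_mul_le] bounds it. *)
Lemma steind_le x : `|steind x| <= Num.sqrt (2 / pi).
Proof.
have p0 := phi_gt0 x.
have -> : Num.sqrt (2 / pi) = 2 * phi 0 :> R by rewrite phi0_sqrtE.
rewrite steindE normrM normfV (gtr0_norm p0) ler_pdivrMr// normrN.
apply: (le_trans (ler_normD _ _)); rewrite !normrM.
rewrite (ger0_norm (excess_ge0 x)) (ger0_norm (excess_ge0 (- x))).
have := ler_wpM2l (excess_ge0 x) (lower_le x).
have := ler_wpM2l (excess_ge0 (- x)) (upper_le x).
by have := excess_mul_le x; lra.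
Qed.

(* The derivative of x * stein x is a combination of lower x and - upper x with
nonnegative coefficients, so it is largest when both are extreme, as happens
for an h of slope -1, where stein is constantly 1. *)
Let xsteind_le x : `|stein x + x * steind x| <= 1.
Proof.
have p0 := phi_gt0 x.
have -> : stein x + x * steind x =
    (excess2 x * lower x - excess2 (- x) * upper x) / phi x.
  rewrite steinE steindE /excess2 Psi_reflect excessN.
  by field; rewrite gt_eqF.
rewrite normrM normfV (gtr0_norm p0) ler_pdivrMr// mul1r.
apply: (le_trans (ler_normB _ _)); rewrite !normrM.
rewrite (ger0_norm (excess2_ge0 x)) (ger0_norm (excess2_ge0 (- x))).
apply: (le_trans (lerD (ler_wpM2l (excess2_ge0 x) (lower_le x))
  (ler_wpM2l (excess2_ge0 (- x)) (upper_le x)))).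
rewrite /excess2 Psi_reflect excessN /excess /Psi.
by rewrite le_eqVlt; apply/orP; left; apply/eqP; ring.
Qed.

(** The sum of the two 1-Lipschitz terms [h] and [x * stein x]. *)
Lemma steind_lipschitz x y : `|steind x - steind y| <= 2 * `|x - y|.
Proof.
have dF (z : R) :
    is_derive z 1 (fun z => z * stein z) (stein z + z * steind z).
  have dS := is_derive_stein z.
  by apply: is_derive1_eq; rewrite /GRing.scale/=; ring.
have := is_derive1_lipschitz dF xsteind_le x y; have := lip_h x y.
rewrite /steind => a1 a2.
have -> : x * stein x + (h x - normal_mean)
  - (y * stein y + (h y - normal_mean)) =
  (x * stein x - y * stein y) + (h x - h y) by ring.
by apply: (le_trans (ler_normD _ _)); lra.
Qed.

End stein.

(** * Expectations under the normal law *)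

Section normal_expectation.
Context {R : realType}.
Notation mu := (@lebesgue_measure R).

(* The Radon-Nikodym derivative of the normal law is its density almost
everywhere. *)
Let ge0_integral_normal_prob (f : R -> \bar R) : (forall x, (0 <= f x)%E) ->
  measurable_fun setT f ->
  (\int[normal_prob 0 1]_x f x = \int[mu]_x (f x * (phi x)%:E))%E.
Proof.
move=> f0 mf; have dom := normal_prob_dominates (0 : R) 1.
rewrite -(Radon_Nikodym_SigmaFinite.change_of_variables dom)//.
have fi := Radon_Nikodym_SigmaFinite.f_integrable dom.
have mphi : measurable_fun [set: R] (EFin \o (@phi R)).
  by apply/measurable_EFinP; exact: measurable_normal_pdf.
apply: ae_eq_integral => //.
- by apply: emeasurable_funM => //; exact: measurable_int fi.
- exact: emeasurable_funM.
apply: ae_eqe_mul2l; apply: integral_ae_eq => // E _ mE.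
by rewrite -Radon_Nikodym_SigmaFinite.f_integral.
Qed.

Context d (T : measurableType d) (P : probability T R) (Z : {RV P >-> R}).
Hypothesis Z_normal : forall B : set R, measurable B ->
  distribution P Z B = normal_prob 0 1 B.

Lemma expectation_normal (h : R -> R) : measurable_fun setT h ->
  ('E_P[h \o Z] = \int[mu]_x (h x * phi x)%:E)%E.
Proof.
move=> mh; have mEh : measurable_fun setT (EFin \o h) by exact/measurable_EFinP.
have ge0E (f : R -> \bar R) : (forall x, (0 <= f x)%E) ->
    measurable_fun setT f ->
    (\int[P]_t f (Z t) = \int[mu]_x (f x * (phi x)%:E))%E.
  move=> f0 mf; rewrite -ge0_integral_normal_prob//.
  (* Random variables and the normal law use two displays of the same Borel
     sets, hence the recast of Z. *)
  pose S := measurableTypeR R.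
  have mZ : measurable_fun [set: T] (Z : T -> S).
    exact: (measurable_funPT Z).
  pose mZ_mixin := isMeasurableFun.Build _ _ _ S _ mZ.
  pose ZS : {mfun T >-> S} := HB.pack (Z : T -> S) mZ_mixin.
  rewrite -(ge0_integral_distribution (P := P) (T' := S) ZS mf f0).
  apply: (@eq_measure_integral _ S R setT (normal_prob 0 1)) => A mA _.
  exact: Z_normal.
have pos (s : R) :
    (\int[P]_t (Num.max (s * h (Z t)) 0)%:E
     = \int[mu]_x (Num.max (s * (h x * phi x)) 0)%:E)%E.
  rewrite (ge0E (fun x => (Num.max (s * h x) 0)%:E)).
  - apply: eq_integral => x _.
    by rewrite -EFinM maxr_pMl ?(ltW (phi_gt0 _))// mul0r mulrA.
  - by move=> x; rewrite lee_fin le_max lexx orbT.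
  - apply/measurable_EFinP/measurable_maxr => //.
    exact: measurable_funM.
have parts (d1 : measure_display) (T1 : measurableType d1)
    (m : {measure set T1 -> \bar R}) (f : T1 -> R) :
    (\int[m]_t (f t)%:E = \int[m]_t (Num.max (1 * f t) 0)%:E
      - \int[m]_t (Num.max (- 1 * f t) 0)%:E)%E.
  rewrite integralE; congr (_ - _)%E; apply: eq_integral => t _.
    by rewrite funeposE mul1r EFin_max.
  by rewrite funenegE mulN1r EFin_max EFinN.
by rewrite unlock parts (pos 1) (pos (- 1)) -parts.
Qed.

End normal_expectation.

(** * Real-valued expectations *)

Section expectation.
Context d (T : measurableType d) (R : realType) (P : probability T R).
Implicit Types X Y : T -> R.

Definition finite_mean X : Prop := P.-integrable setT (EFin \o X).
Definition mean X : R := \int[P]_t X t.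

Lemma expectation_mean X : finite_mean X -> ('E_P[X] = (mean X)%:E)%E.
Proof.
move=> sX; rewrite unlock /mean /Rintegral fineK//.
exact: integrable_fin_num.
Qed.

Lemma finite_mean_measurable X : finite_mean X -> measurable_fun setT X.
Proof. by case/integrableP => /measurable_EFinP. Qed.

Lemma finite_mean_cst (c : R) : finite_mean (fun=> c).
Proof. exact: finite_measure_integrable_cst. Qed.

Lemma finite_meanD X Y :
  finite_mean X -> finite_mean Y -> finite_mean (fun t => X t + Y t).
Proof. by move=> sX sY; have := integrableD measurableT sX sY. Qed.

Lemma finite_meanB X Y :
  finite_mean X -> finite_mean Y -> finite_mean (fun t => X t - Y t).
Proof. by move=> sX sY; have := integrableB measurableT sX sY. Qed.

Lemma finite_meanZ c X : finite_mean X -> finite_mean (fun t => c * X t).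
Proof. by move=> sX; have := integrableZl measurableT c sX. Qed.

Lemma finite_mean_le X Y : measurable_fun setT X ->
  (forall t, `|X t| <= Y t) -> finite_mean Y -> finite_mean X.
Proof.
move=> mX XY; apply: le_integrable => //; first exact/measurable_EFinP.
by move=> t _; rewrite lee_fin (le_trans (XY t))// ler_norm.
Qed.

Lemma finite_mean_ge0 X : measurable_fun setT X -> (forall t, 0 <= X t) ->
  ('E_P[X] < +oo)%E -> finite_mean X.
Proof.
move=> mX X0; rewrite unlock => Xoo; apply/integrableP; split.
  exact/measurable_EFinP.
by under eq_integral do rewrite /= ger0_norm//.
Qed.

Lemma finite_mean_abs X : finite_mean X -> finite_mean (fun t => `|X t|).
Proof. by move=> sX; have := integrable_abse sX. Qed.

Lemma finite_mean_sqr X : measurable_fun setT X ->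
  finite_mean (fun t => X t ^+ 2) -> finite_mean X.
Proof.
move=> mX X2.
apply: (finite_mean_le mX _ (finite_meanD (finite_mean_cst 1) X2)) => t.
rewrite -[X t ^+ 2]real_normK ?num_real//.
by have := sqr_ge0 (`|X t| - 2^-1); lra.
Qed.

Lemma finite_mean_indicator (a : R) X Y : measurable_fun setT Y ->
  finite_mean X -> finite_mean (fun t => (a <= Y t)%R%:R * X t).
Proof.
move=> mY fX; apply: (finite_mean_le _ _ (finite_mean_abs fX)) => [|t].
  apply: measurable_funM; last exact: finite_mean_measurable fX.
  have -> : (fun t => (a <= Y t)%R%:R) = \1_(Y @^-1` `[a, +oo[) :> (T -> R).
    apply/funext => t; rewrite indicE; congr (nat_of_bool _)%:R.
    by apply/idP/idP; rewrite inE /= in_itv/= andbT.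
  by apply: measurable_indic; rewrite -[X in measurable X]setTI; exact: mY.
by rewrite normrM ler_piMl// normr_nat lern1 leq_b1.
Qed.

Lemma finite_mean_growth (g : R -> R) (a b : R) X : measurable_fun setT g ->
  (forall x, `|g x| <= a + b * `|x|) -> finite_mean X ->
  finite_mean (fun t => g (X t)).
Proof.
move=> mg gab fX; have mX := finite_mean_measurable fX.
apply: (finite_mean_le _ _ (finite_meanD (finite_mean_cst a)
  (finite_meanZ b (finite_mean_abs fX)))) => [|t]; last exact: gab.
exact: measurableT_comp.
Qed.

Lemma mean_cst (c : R) : mean (fun=> c) = c.
Proof. by rewrite /mean Rintegral_cst//= probability_setT mulr1. Qed.

Lemma meanD X Y : finite_mean X -> finite_mean Y ->
  mean (fun t => X t + Y t) = mean X + mean Y.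
Proof. exact: RintegralD. Qed.

Lemma meanB X Y : finite_mean X -> finite_mean Y ->
  mean (fun t => X t - Y t) = mean X - mean Y.
Proof. exact: RintegralB. Qed.

Lemma meanZ c X : finite_mean X -> mean (fun t => c * X t) = c * mean X.
Proof. exact: RintegralZl. Qed.

Lemma mean_sum (I : finType) (D : pred I) (X : I -> T -> R) :
  (forall i, D i -> finite_mean (X i)) ->
  finite_mean (fun t => \sum_(i | D i) X i t) /\
  mean (fun t => \sum_(i | D i) X i t) = \sum_(i | D i) mean (X i).
Proof.
move=> sX; elim: (index_enum I) => [|i r [sr mr]].
  rewrite big_nil; under eq_fun do rewrite big_nil.
  by rewrite mean_cst; split => //; exact: finite_mean_cst.
rewrite big_cons; under eq_fun do rewrite big_cons.
case: ifPn => // Di; split; first exact: finite_meanD (sX i Di) sr.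
by rewrite meanD ?mr//; exact: sX.
Qed.

Lemma mean_le X Y : finite_mean X -> finite_mean Y -> (forall t, X t <= Y t) ->
  mean X <= mean Y.
Proof. by move=> sX sY XY; apply: le_Rintegral. Qed.

Lemma mean_ge0 X : (forall t, 0 <= X t) -> 0 <= mean X.
Proof. by move=> X0; apply: Rintegral_ge0. Qed.

Lemma mean_abs_le X Y : finite_mean X -> finite_mean Y ->
  (forall t, `|X t| <= Y t) -> `|mean X| <= mean Y.
Proof.
move=> sX sY XY; apply: (le_trans (le_normr_Rintegral _ sX)) => //.
by apply: mean_le => //; exact: finite_mean_abs.
Qed.

(** Dominated convergence along a sequence that is pointwise eventually
constant. *)
Lemma mean_le0_limit (X : nat -> T -> R) Y Z :
  (forall n, finite_mean (X n)) -> finite_mean Z ->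
  (forall n t, `|X n t| <= Z t) ->
  (forall t, \forall n \near \oo, X n t = Y t) ->
  (forall n, mean (X n) <= 0) -> finite_mean Y /\ mean Y <= 0.
Proof.
move=> sX sZ XZ XY X0.
have cX t : (X n t)%:E @[n --> \oo] --> (Y t)%:E.
  by apply: cvg_near_cst; near do congr EFin; exact: XY.
have mX n : measurable_fun setT (EFin \o X n).
  by apply/measurable_EFinP; exact: finite_mean_measurable.
have [] := @dominated_convergence _ _ _ P setT measurableT
    (fun n => EFin \o X n) (EFin \o Y) (EFin \o Z) mX.
- by apply: (emeasurable_fun_cvg _ _ mX) => t _; exact: cX.
- by apply: aeW => t _; exact: cX.
- exact: sZ.
- by apply: aeW => t n _; rewrite /= lee_fin.
- move=> sY _ /= cY; split => //.
  move: cY; rewrite -[X in _ --> X]fineK; last exact: integrable_fin_num.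
  move=> /fine_cvg cY; by apply: (cvgr_to_le cY); near=> n; exact: X0.
Unshelve. all: by end_near. Qed.

End expectation.

(** * The increments of [y * g (y + v)] *)

Section increments.
Context {R : realType}.
Variables (g dg : R -> R) (M : R).
Hypothesis is_derive_g : forall x : R, is_derive x 1 g (dg x).
Hypothesis dg_ge0 : forall x, 0 <= dg x.
Hypothesis dg_lip : forall x y, `|dg x - dg y| <= M * `|x - y|.

Let M_ge0 : 0 <= M.
Proof. exact: lipschitz_ge0 dg_lip. Qed.

Let dg_ball x y : x <= y -> dg x - M * (y - x) <= dg y <= dg x + M * (y - x).
Proof.
move=> xy; have := dg_lip y x; rewrite (ger0_norm (x := y - x)) ?subr_ge0//.
by rewrite ler_distl.
Qed.

Let g_ndecr x y : x <= y -> g x <= g y.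
Proof.
move=> xy; rewrite -lerN2.
apply: (is_derive1_le0 (f := fun x => - g x) (df := fun x => - dg x) xy).
by move=> z _; rewrite oppr_le0.
Qed.

Let taylor x u : 0 <= u ->
  g x + u * dg x - M / 2 * u ^+ 2 <= g (x + u) <=
  g x + u * dg x + M / 2 * u ^+ 2.
Proof.
move=> u0; have xu : x <= x + u by rewrite lerDl.
have bnd s : s = 1 \/ s = - 1 ->
    s * (g (x + u) - g x - u * dg x) <= M / 2 * u ^+ 2.
  move=> s1; pose F y := s * (g y - g x - (y - x) * dg x)
    - M / 2 * ((y - x) * (y - x)).
  have : F (x + u) <= F x.
    apply: (is_derive1_le0
      (df := fun y => s * (dg y - dg x) - M * (y - x)) xu).
    - by move=> y _; apply: is_derive1_eq; rewrite /GRing.scale/=; lra.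
    - move=> y /andP[/ltW/dg_ball/andP[xy1 xy2] _].
      by case: s1 => -> /=; lra.
  have xux : x + u - x = u by ring.
  by rewrite /F xux; lra.
have := bnd 1 (or_introl erefl); have := bnd (- 1) (or_intror erefl); lra.
Qed.

(* The left side is the derivative of u * g (u + v) in u.  When u + v <= w, a
slope at u + v larger than the slope at w makes g grow over the next step u,
and g is nondecreasing up to w + u; otherwise u + v and w are within u, and the
slopes within M * u. *)
Let slope_le u v w : 0 <= u -> v <= w ->
  g (u + v) + u * dg (u + v) <= g w + 2 * u * dg w + 3 / 2 * M * u ^+ 2.
Proof.
move=> u0 vw; have /andP[_ gwu] := taylor w u0.
have uM : 0 <= u * dg w by rewrite mulr_ge0.
have [uvw|wuv] := leP (u + v) w.
- have /andP[guv _] := taylor (u + v) u0.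
  have : g (u + v + u) <= g (w + u) by apply: g_ndecr; rewrite lerD2r.
  have : 0 <= M * u ^+ 2 by rewrite mulr_ge0 ?sqr_ge0.
  lra.
- have : g (u + v) <= g (w + u) by apply: g_ndecr; lra.
  have /andP[_ dguv] := dg_ball (ltW wuv).
  have : u * dg (u + v) <= u * (dg w + M * u).
    rewrite ler_wpM2l// (le_trans dguv)// lerD2l ler_wpM2l//; lra.
  rewrite mulrDr expr2 in gwu *; lra.
Qed.

Definition increment (j : nat) v : R :=
  j.+1%:R * g (j.+1%:R + v) - j%:R * g (j%:R + v).

Definition increment_bound (j : nat) (e0 e1 : R) : R :=
  e0 + (j.+1%:R ^+ 2 - j%:R ^+ 2) * e1
  + M / 2 * (j.+1%:R ^+ 3 - j%:R ^+ 3).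

(** The bound at any [w] above [v], not only at [v], is the key to the
comparison: an increment need not be monotone in [v], but this makes its
running supremum obey the same bound. *)
Lemma increment_le j v w : v <= w ->
  increment j v <= increment_bound j (g w) (dg w).
Proof.
move=> vw; pose F y := y * g (y + v) - y * g w - y * y * dg w
  - M / 2 * (y * y * y).
have jj : j%:R <= j.+1%:R :> R by rewrite ler_nat.
have : F j.+1%:R <= F j%:R.
  apply: (is_derive1_le0 (df := fun y => g (y + v) + y * dg (y + v)
      - (g w + 2 * y * dg w + 3 / 2 * M * y ^+ 2)) jj).
  - move=> y _.
    have dgv : is_derive y 1 (fun y => g (y + v)) (dg (y + v)).
      have H : is_derive y 1 (g \o (fun y => y + v)) (dg (y + v) * (1 + 0)).
        exact: is_derive1_comp.
      by apply: (is_derive1_eq H); rewrite addr0 mulr1.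
    by rewrite /F; apply: is_derive1_eq; rewrite /GRing.scale/=; field.
  - move=> y /andP[jy _]; rewrite subr_le0; apply: slope_le => //.
    by rewrite (le_trans _ (ltW jy)).
have j1 : j.+1%:R = j%:R + 1 :> R by rewrite -natr1.
rewrite /F /increment /increment_bound j1; lra.
Qed.

Definition running_sup (j : nat) v : R :=
  sup [set increment j x | x in `]-oo, v]].

Let range_ubound j v w : v <= w ->
  ubound [set increment j x | x in `]-oo, v]] (increment_bound j (g w) (dg w)).
Proof.
move=> vw _ [x xv <-]; apply: increment_le; by rewrite (le_trans _ vw).
Qed.

Let in_range j v : [set increment j x | x in `]-oo, v]] (increment j v).
Proof. by exists v => //=; rewrite in_itv/=. Qed.

Lemma increment_le_running_sup j v : increment j v <= running_sup j v.
Proof.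
apply: ub_le_sup; last exact: in_range.
by exists (increment_bound j (g v) (dg v)); exact: range_ubound.
Qed.

Lemma running_sup_le j v w : v <= w ->
  running_sup j v <= increment_bound j (g w) (dg w).
Proof.
by move=> vw; apply: ge_sup; [exists (increment j v)|exact: range_ubound].
Qed.

Lemma running_sup_ndecr j v w : v <= w -> running_sup j v <= running_sup j w.
Proof.
move=> vw; apply: ge_sup; first by exists (increment j v).
move=> _ [x xv <-]; apply: ub_le_sup.
  by exists (increment_bound j (g w) (dg w)); exact: range_ubound.
by exists x => //; move: xv; rewrite /= !in_itv/= => /le_trans; apply.
Qed.

End increments.

(** * The comparison for a negatively dependent pair *)

Section pair.
Context d (T : measurableType d) (R : realType) (P : probability T R).
Variables (g dg : R -> R) (M B : R).
Hypothesis is_derive_g : forall x : R, is_derive x 1 g (dg x).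
Hypothesis dg_ge0 : forall x, 0 <= dg x.
Hypothesis dg_le : forall x, dg x <= B.
Hypothesis dg_lip : forall x y, `|dg x - dg y| <= M * `|x - y|.

Variables Y V : T -> R.
Hypothesis mY : measurable_fun setT Y.
Hypothesis mV : measurable_fun setT V.
Hypothesis Y_nat : forall t, exists N : nat, Y t = N%:R.
Hypothesis Y3 : finite_mean P (fun t => Y t ^+ 3).
Hypothesis V2 : finite_mean P (fun t => V t ^+ 2).
Hypothesis nqd : forall (j : nat) (c : R -> R),
  (forall x y, x <= y -> c x <= c y) -> finite_mean P (fun t => c (V t)) ->
  mean P (fun t => (j.+1%:R <= Y t)%R%:R * c (V t)) <=
  mean P (fun t => (j.+1%:R <= Y t)%R%:R) * mean P (fun t => c (V t)).

Let W t := Y t + V t.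

Let B_ge0 : 0 <= B. Proof. exact: le_trans (dg_ge0 0) (dg_le 0). Qed.

Let M_ge0 : 0 <= M.
Proof. exact: lipschitz_ge0 dg_lip. Qed.

Let g_lip x y : `|g x - g y| <= B * `|x - y|.
Proof. by apply: is_derive1_lipschitz => // z; rewrite ger0_norm. Qed.

Let g_growth := lipschitz_growth g_lip.

Let mg : measurable_fun setT g.
Proof. exact: continuous_measurable_fun (lipschitz_continuous g_lip). Qed.

Let mdg : measurable_fun setT dg.
Proof. exact: continuous_measurable_fun (lipschitz_continuous dg_lip). Qed.

Let Y_ge0 t : 0 <= Y t. Proof. by have [N ->] := Y_nat t. Qed.

Let Y_le2 t : Y t <= Y t ^+ 2.
Proof.
have [N ->] := Y_nat t; rewrite -natrX ler_nat -mulnn.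
by case: N => // N; exact: leq_pmull.
Qed.

Let Y2_le3 t : Y t ^+ 2 <= Y t ^+ 3.
Proof. by rewrite [leRHS]exprS [leLHS]exprS expr1 ler_wpM2l. Qed.

Let mW : measurable_fun setT W. Proof. exact: measurable_funD. Qed.

Let fY2 : finite_mean P (fun t => Y t ^+ 2).
Proof.
apply: finite_mean_le Y3; first exact: measurable_funX.
by move=> t; rewrite ger0_norm ?sqr_ge0.
Qed.

Let fY : finite_mean P Y.
Proof. by apply: finite_mean_le fY2 => // t; rewrite ger0_norm. Qed.

Let fV : finite_mean P V. Proof. exact: finite_mean_sqr. Qed.

Let fW : finite_mean P W. Proof. exact: finite_meanD. Qed.

Let f_growth (X : T -> R) : finite_mean P X -> finite_mean P (fun t => g (X t)).
Proof. exact: finite_mean_growth. Qed.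

Let fdg (X : T -> R) : finite_mean P X -> finite_mean P (fun t => dg (X t)).
Proof. by apply: (finite_mean_growth mdg); exact: lipschitz_growth. Qed.

Let tail (j : nat) t : R := (j.+1%:R <= Y t)%R%:R.

Let f_tail j (X : T -> R) : finite_mean P X ->
  finite_mean P (fun t => tail j t * X t).
Proof. exact: finite_mean_indicator. Qed.

Let increment_g (j : nat) t : R := increment g j (V t).

Let f_increment j : finite_mean P (increment_g j).
Proof.
have fg (a : R) : finite_mean P (fun t => a * g (a + V t)).
  by apply/finite_meanZ/f_growth; exact: finite_meanD (finite_mean_cst P a) fV.
exact: finite_meanB (fg _) (fg _).
Qed.

Let running j v := running_sup g j v.

Let f_bound j (X : T -> R) : finite_mean P X ->
  finite_mean P (fun t => increment_bound M j (g (X t)) (dg (X t))).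
Proof.
move=> fX; apply: finite_meanD; last exact: finite_mean_cst.
by apply: finite_meanD; [exact: f_growth|apply: finite_meanZ; exact: fdg].
Qed.

Let f_running j : finite_mean P (fun t => running j (V t)).
Proof.
apply: (finite_mean_le _ _ (finite_meanD (finite_mean_abs (f_increment j))
  (finite_mean_abs (f_bound j fV)))) => [|t].
  apply: (measurableT_comp (f := running j)) => //.
  apply: nondecreasing_measurable => // x y.
  exact: (running_sup_ndecr is_derive_g dg_ge0 dg_lip).
have l1 := increment_le_running_sup is_derive_g dg_ge0 dg_lip j (V t).
have l2 := running_sup_le is_derive_g dg_ge0 dg_lip j (lexx (V t)).
have := ler_norm (increment_bound M j (g (V t)) (dg (V t))).
have := ler_norm (- increment_g j t); rewrite normrN /increment_g.
have := normr_ge0 (increment_bound M j (g (V t)) (dg (V t))).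
have := normr_ge0 (increment g j (V t)).
by rewrite ler_norml /running; lra.
Qed.

Let e0 := mean P (fun t => g (W t)).
Let e1 := mean P (fun t => dg (W t)).

(* Negative dependence applies to the nondecreasing running supremum, and W is
one of the points above V at which the supremum is bounded. *)
Let mean_increment_le j :
  mean P (fun t => tail j t * (increment g j (V t) - increment_bound M j e0 e1))
  <= 0.
Proof.
set b := increment_bound M j e0 e1.
have -> : (fun t => tail j t * (increment g j (V t) - b)) =
    (fun t => tail j t * increment g j (V t) - b * (tail j t * 1)).
  by apply/funext => t; ring.
have ftail := f_tail j (finite_mean_cst P 1).
rewrite meanB; [|by apply: f_tail; exact: f_increment|exact: finite_meanZ].
rewrite meanZ// subr_le0.
apply: (@le_trans _ _ (mean P (fun t => tail j t * running j (V t)))).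
  apply: mean_le => [||t]; [by apply: f_tail; exact: f_increment|
    by apply: f_tail; exact: f_running|].
  by rewrite ler_wpM2l// (increment_le_running_sup is_derive_g dg_ge0 dg_lip).
apply: (le_trans (nqd _ _ (f_running j))).
  by move=> x y; exact: (running_sup_ndecr is_derive_g dg_ge0 dg_lip).
rewrite mulrC; under [X in _ <= _ * mean P X]eq_fun do rewrite mulr1.
rewrite ler_wpM2r ?mean_ge0//.
have -> : b = mean P (fun t => increment_bound M j (g (W t)) (dg (W t))).
  rewrite /increment_bound meanD; [|exact: finite_meanD (f_growth fW)
    (finite_meanZ _ (fdg fW))|exact: finite_mean_cst].
  rewrite meanD; [|exact: f_growth|exact: finite_meanZ (fdg fW)].
  by rewrite mean_cst meanZ//; exact: fdg.
apply: mean_le => [||t]; [exact: f_running|exact: f_bound|].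
by apply: (running_sup_le is_derive_g dg_ge0 dg_lip); rewrite lerDr.
Qed.

Let defect y v : R :=
  y * g (y + v) - y * e0 - y ^+ 2 * e1 - M / 2 * y ^+ 3.

(* The truncation at m makes the sum over the levels of Y finite. *)
Let defect_telescope (m N : nat) v :
  defect (minn N m)%:R v =
  \sum_(j < m) (j.+1%:R <= N%:R :> R)%R%:R *
    (increment g j v - increment_bound M j e0 e1).
Proof.
elim: m => [|m IHm].
  rewrite big_ord0 minn0 /defect.
  by rewrite !mul0r !expr0n/= !mul0r mulr0 !subr0.
rewrite big_ord_recr/= -IHm ler_nat; have [mN|Nm] := ltnP m N.
  rewrite (minn_idPr mN) mul1r.
  by rewrite /defect /increment /increment_bound; ring.
by rewrite mul0r addr0 (minn_idPl (leqW Nm)).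
Qed.

Let growth y t : 0 <= y <= Y t ->
  `|y * g (y + V t)| <= Y t * `|g 0| + B * (2 * Y t ^+ 2 + V t ^+ 2).
Proof.
move=> /andP[y0 yY]; rewrite normrM (ger0_norm y0).
apply: (@le_trans _ _ (Y t * (`|g 0| + B * (Y t + `|V t|)))).
  apply: ler_pM => //; apply: (le_trans (g_growth _)).
  rewrite lerD2l ler_wpM2l//; apply: (le_trans (ler_normD _ _)).
  by rewrite lerD2r ger0_norm.
rewrite mulrDr lerD2l mulrCA ler_wpM2l// -[V t ^+ 2]real_normK ?num_real//.
have := sqr_ge0 (Y t); have := sqr_ge0 `|V t|.
by have := sqr_ge0 (Y t - `|V t|); lra.
Qed.

Let f_envelope : finite_mean P
  (fun t => Y t * `|g 0| + B * (2 * Y t ^+ 2 + V t ^+ 2)).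
Proof.
apply: finite_meanD.
  by under eq_fun do rewrite mulrC; exact: finite_meanZ.
by apply: finite_meanZ; apply: finite_meanD => //; exact: finite_meanZ.
Qed.

(** For nondecreasing [g] this replaces the [Y] in front of [g (Y + V)] by an
independent copy.  The map [(y, v) |-> y * g (y + v)] is not supermodular, so
negative dependence does not apply to it directly: it is summed over its
increments in [y], each replaced by a nondecreasing majorant in [v]. *)
Lemma mean_pair_le :
  mean P (fun t => Y t * g (Y t + V t)) <=
  mean P Y * mean P (fun t => g (Y t + V t))
  + mean P (fun t => Y t ^+ 2) * mean P (fun t => dg (Y t + V t))
  + M / 2 * mean P (fun t => Y t ^+ 3).
Proof.
rewrite -/(W _) -/e0 -/e1.
pose X m t := defect (Num.min (Y t) m%:R) (V t).
pose Z t := Y t * `|g 0| + B * (2 * Y t ^+ 2 + V t ^+ 2) + `|e0| * Y t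
  + `|e1| * Y t ^+ 2 + M / 2 * Y t ^+ 3.
have XE m : X m = fun t => \sum_(j < m) tail j t *
    (increment g j (V t) - increment_bound M j e0 e1).
  apply/funext => t; have [N YN] := Y_nat t.
  rewrite /X /tail YN -defect_telescope; congr defect.
  by rewrite -natr_min.
have fXj (m : nat) (j : 'I_m) : finite_mean P (fun t => tail j t *
    (increment g j (V t) - increment_bound M j e0 e1)).
  by apply: f_tail; apply: finite_meanB (f_increment j) (finite_mean_cst _ _).
have fYg : finite_mean P (fun t => Y t * g (W t)).
  apply: (finite_mean_le _ _ f_envelope) => [|t]; last first.
    by apply: growth; rewrite Y_ge0 lexx.
  by apply: measurable_funM => //; exact: measurableT_comp.
have [] := @mean_le0_limit _ _ _ P X (fun t => defect (Y t) (V t)) Z.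
- move=> m; rewrite XE.
  by have [] := mean_sum (fun (j : 'I_m) (_ : true) => fXj m j).
- apply: finite_meanD; last exact: finite_meanZ.
  apply: finite_meanD; last exact: finite_meanZ.
  by apply: finite_meanD; last exact: finite_meanZ.
- move=> m t; rewrite /X; set y := Num.min _ _.
  have y0 : 0 <= y by rewrite le_min Y_ge0 ler0n.
  have yY : y <= Y t by rewrite ge_min lexx.
  rewrite /defect /Z; apply: (le_trans (ler_normB _ _)); apply: lerD.
    apply: (le_trans (ler_normB _ _)); apply: lerD.
      apply: (le_trans (ler_normB _ _)); apply: lerD.
        by apply: growth; rewrite y0.
      by rewrite mulrC normrM ler_wpM2l// ger0_norm.
    by rewrite mulrC normrM ler_wpM2l// ger0_norm ?sqr_ge0// lerXn2r ?nnegrE.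
  rewrite normrM ger0_norm ?divr_ge0//.
  by rewrite ler_wpM2l ?divr_ge0// ger0_norm ?exprn_ge0// lerXn2r ?nnegrE.
- move=> t; near=> m; rewrite /X (min_idPl _)//.
  by near: m; exact: nbhs_infty_ger.
- move=> m; rewrite XE.
  have [_ ->] := mean_sum (fun (j : 'I_m) (_ : true) => fXj m j).
  by apply: sumr_le0 => j _; exact: mean_increment_le.
move=> _.
have -> : (fun t => defect (Y t) (V t)) = (fun t => Y t * g (W t)
    - e0 * Y t - e1 * Y t ^+ 2 - M / 2 * Y t ^+ 3).
  by apply/funext => t; rewrite /defect (mulrC _ e0) (mulrC _ e1).
have f1 := finite_meanB fYg (finite_meanZ e0 fY).
have f2 := finite_meanB f1 (finite_meanZ e1 fY2).
rewrite (meanB f2 (finite_meanZ _ Y3)) (meanB f1 (finite_meanZ _ fY2)).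
rewrite (meanB fYg (finite_meanZ _ fY)) (meanZ _ fY) (meanZ _ fY2) (meanZ _ Y3).
lra.
Unshelve. all: by end_near. Qed.

End pair.

(** * Sums of negatively associated variables *)

Section negative_association.
Context d (T : measurableType d) (R : realType) (P : probability T R).
Context (n : nat) (Y : 'I_n -> T -> R).
Hypothesis mY : forall i, measurable_fun setT (Y i).
Hypothesis Y_na : negatively_associated P Y.

Let rest k t : R := \sum_(i < n | i != k) Y i t.

Lemma na_tail_le k (a : R) (c : R -> R) :
  (forall x y, x <= y -> c x <= c y) -> finite_mean P (fun t => c (rest k t)) ->
  mean P (fun t => (a <= Y k t)%R%:R * c (rest k t)) <=
  mean P (fun t => (a <= Y k t)%R%:R) * mean P (fun t => c (rest k t)).
Proof.
move=> c_homo fc.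
have kk : k \in [set k]%SET by rewrite inE.
pose g (x : {i | i \in [set k]%SET} -> R) : R := (a <= x (exist _ k kk))%R%:R.
pose h (x : {i | i \in [set~ k]%SET} -> R) : R := c (\sum_i x i).
have hE t : h (fun i => Y (val i) t) = c (rest k t).
  congr c; rewrite -(big_sub [in [set~ k]%SET] (fun i => Y i t)).
  by apply: eq_bigl => i; rewrite !inE.
have hE' : (fun t => h (fun i => Y (val i) t)) = (fun t => c (rest k t)).
  exact/funext.
have dis : [disjoint [set k]%SET & [set~ k]%SET]%B.
  by rewrite -setI_eq0 finset.setICr.
have g_homo : coord_nondecreasing g.
  move=> x y xy; rewrite /g ler_nat; case: (leP a _) => // /le_trans ax.
  by rewrite (ax _ (xy _)).
have h_homo : coord_nondecreasing h.
  by move=> x y xy; apply: c_homo; exact: ler_sum.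
have fg1 : finite_mean P (fun t => (a <= Y k t)%R%:R).
  have := finite_mean_indicator a (mY k) (finite_mean_cst P 1).
  by under eq_fun do rewrite mulr1.
have fgc := finite_mean_indicator a (mY k) fc.
have fh : finite_mean P (fun t => h (fun i => Y (val i) t)) by rewrite hE'.
have fgh : finite_mean P
    (fun t => (a <= Y k t)%R%:R * h (fun i => Y (val i) t)).
  by under eq_fun do rewrite hE.
have : ('E_P[fun t => ((a <= Y k t)%R%:R * h (fun i => Y (val i) t))%R] <=
        'E_P[fun t => (a <= Y k t)%R%:R] *
        'E_P[fun t => h (fun i => Y (val i) t)])%E.
  exact: (Y_na dis g_homo h_homo fg1 fh fgh).
rewrite (expectation_mean fg1) (expectation_mean fh) (expectation_mean fgh).
rewrite -EFinM lee_fin hE'.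
by under eq_fun do rewrite hE.
Qed.

Hypothesis Y_nat : forall i t, exists N : nat, Y i t = N%:R.
Hypothesis Y3 : forall i, finite_mean P (fun t => Y i t ^+ 3).

Let W t : R := \sum_(i < n) Y i t.
Hypothesis W2 : finite_mean P (fun t => W t ^+ 2).

Let Y_ge0 i t : 0 <= Y i t. Proof. by have [N ->] := Y_nat i t. Qed.

Let mW : measurable_fun setT W.
Proof. exact: measurable_sum. Qed.

Let WE k t : W t = Y k t + rest k t.
Proof. by rewrite /W (bigD1 k). Qed.

Let rest_ge0 k t : 0 <= rest k t. Proof. exact: sumr_ge0. Qed.

Let m_rest k : measurable_fun setT (rest k).
Proof.
have -> : rest k = fun t => W t - Y k t.
  by apply/funext => t; rewrite (WE k); ring.
exact: measurable_funB.
Qed.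

Let fW : finite_mean P W. Proof. exact: finite_mean_sqr. Qed.

Let le_W (X : T -> R) : measurable_fun setT X -> (forall t, 0 <= X t <= W t) ->
  finite_mean P X /\ finite_mean P (fun t => X t ^+ 2).
Proof.
move=> mX XW; split.
  apply: finite_mean_le fW => // t.
  by have /andP[X0 ?] := XW t; rewrite ger0_norm.
apply: finite_mean_le W2 => [|t]; first exact: measurable_funX.
have /andP[X0 XWt] := XW t.
by rewrite ger0_norm ?sqr_ge0// lerXn2r ?nnegrE// (le_trans X0).
Qed.

Let Y_le_W k t : 0 <= Y k t <= W t.
Proof. by rewrite Y_ge0 (WE k) lerDl rest_ge0. Qed.

Let rest_le_W k t : 0 <= rest k t <= W t.
Proof. by rewrite rest_ge0 (WE k) lerDr Y_ge0. Qed.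

Let fY k := (le_W (mY k) (Y_le_W k)).1.

Lemma finite_mean_mul i j : finite_mean P (fun t => Y i t * Y j t).
Proof.
apply: (finite_mean_le _ _ W2) => [|t]; first exact: measurable_funM.
have /andP[i0 iW] := Y_le_W i t; have /andP[j0 jW] := Y_le_W j t.
by rewrite ger0_norm ?mulr_ge0// expr2 ler_pM.
Qed.

Lemma mean_sqr_sumE : mean P (fun t => W t ^+ 2) =
  \sum_i \sum_j mean P (fun t => Y i t * Y j t).
Proof.
have fYY i : forall j, true -> finite_mean P (fun t => Y i t * Y j t).
  by move=> j _; exact: finite_mean_mul.
have -> : (fun t => W t ^+ 2) = fun t => \sum_i \sum_j Y i t * Y j t.
  apply/funext => t; rewrite expr2 mulr_suml; apply: eq_bigr => i _.
  by rewrite mulr_sumr.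
have [_ ->] := mean_sum (fun (i : 'I_n) (_ : true) => (mean_sum (fYY i)).1).
by apply: eq_bigr => i _; have [_ ->] := mean_sum (fYY i).
Qed.

Lemma mean_na_sum_le (g dg : R -> R) (M B : R) :
  (forall x : R, is_derive x 1 g (dg x)) -> (forall x, 0 <= dg x) ->
  (forall x, dg x <= B) -> (forall x y, `|dg x - dg y| <= M * `|x - y|) ->
  mean P (fun t => W t * g (W t)) <=
  mean P W * mean P (fun t => g (W t))
  + (\sum_k mean P (fun t => Y k t ^+ 2)) * mean P (fun t => dg (W t))
  + M / 2 * \sum_k mean P (fun t => Y k t ^+ 3).
Proof.
move=> dgP dg0 dgB dgM.
have g_lip : forall x y, `|g x - g y| <= B * `|x - y|.
  by apply: is_derive1_lipschitz => // z; rewrite ger0_norm.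
have mg := continuous_measurable_fun (lipschitz_continuous g_lip).
have fYg k : finite_mean P (fun t => Y k t * g (W t)).
  apply: (finite_mean_le _ _ (finite_meanD (finite_meanZ `|g 0| fW)
    (finite_meanZ B W2))) => [|t].
    by apply: measurable_funM => //; exact: measurableT_comp.
  have /andP[Y0 YW] := Y_le_W k t; rewrite normrM (ger0_norm Y0).
  have -> : `|g 0| * W t + B * W t ^+ 2 = W t * (`|g 0| + B * W t) by ring.
  apply: ler_pM => //; apply: (le_trans (lipschitz_growth g_lip _)).
  by rewrite (ger0_norm (le_trans Y0 YW)).
have -> : (fun t => W t * g (W t)) = fun t => \sum_k Y k t * g (W t).
  by apply/funext => t; rewrite /W mulr_suml.
have [_ ->] := mean_sum (fun (k : 'I_n) (_ : true) => fYg k).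
have [_ ->] := mean_sum (fun (k : 'I_n) (_ : true) => fY k).
rewrite !mulr_suml mulr_sumr -!big_split; apply: ler_sum => k _ /=.
under eq_fun do rewrite (WE k).
under [X in _ <= _ * mean P X + _ + _]eq_fun do rewrite (WE k).
under [X in _ <= _ + _ * mean P X + _]eq_fun do rewrite (WE k).
apply: (mean_pair_le dgP dg0 dgB dgM (mY k) (m_rest k)) => //.
- exact: (le_W (m_rest k) (rest_le_W k)).2.
- by move=> j c c_homo fc; exact: na_tail_le.
Qed.

Let mu := mean P W.
Variable sigma : R.
Hypothesis sigma_gt0 : 0 < sigma.
Hypothesis sigmaE : sigma ^+ 2 = mean P (fun t => (W t - mu) ^+ 2).

Let S2 : R := \sum_k mean P (fun t => Y k t ^+ 2).
Let S3 : R := \sum_k mean P (fun t => Y k t ^+ 3).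

Let W2E : mean P (fun t => W t ^+ 2) = sigma ^+ 2 + mu ^+ 2.
Proof.
rewrite sigmaE.
have -> : (fun t => (W t - mu) ^+ 2) =
    (fun t => W t ^+ 2 - (2 * mu) * W t + mu ^+ 2).
  by apply/funext => t; ring.
have f1 := finite_meanB W2 (finite_meanZ (2 * mu) fW).
rewrite (meanD f1 (finite_mean_cst _ _)) (meanB W2 (finite_meanZ _ fW)).
by rewrite (meanZ _ fW) mean_cst -/mu; ring.
Qed.

(** The comparison for the identity, with [M = 0]. *)
Lemma na_variance_le : sigma ^+ 2 <= S2.
Proof.
have := @mean_na_sum_le (fun x => x) (fun=> 1) 0 1.
have d1 (x : R) : is_derive x 1 (fun x : R => x) 1 by exact: is_derive1_id.
have l0 (x y : R) : `|1 - 1 : R| <= 0 * `|x - y| by rewrite subrr normr0 mul0r.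
move=> /(_ d1 (fun=> ler01) (fun=> lexx _) l0).
under eq_fun do rewrite -expr2 -/(W _).
rewrite W2E mean_cst !mul0r -/mu -/S2; lra.
Qed.

Lemma sum_sqr_mean_gt0 : 0 < S2.
Proof.
have Y2_ge0 i : true -> 0 <= mean P (fun t => Y i t ^+ 2).
  by move=> _; apply: mean_ge0 => t; exact: sqr_ge0.
rewrite lt0r sumr_ge0// andbT; apply/negP => /eqP /(psumr_eq0P Y2_ge0) Y20.
have : 0 < mean P (fun t => W t ^+ 2).
  by rewrite W2E ltr_wpDr ?sqr_ge0// exprn_gt0.
apply/negP; rewrite -leNgt mean_sqr_sumE.
apply: sumr_le0 => i _; apply: sumr_le0 => j _.
rewrite -(addr0 0) -{1}(Y20 i isT) -(Y20 j isT).
have fY2 k := (le_W (mY k) (Y_le_W k)).2.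
rewrite -meanD//; apply: mean_le => [||t].
- exact: finite_mean_mul.
- exact: finite_meanD.
- have := sqr_ge0 (Y i t); have := sqr_ge0 (Y j t).
  by have := sqr_ge0 (Y i t - Y j t); lra.
Qed.

Lemma covariance_defectE :
  - (\sum_(i < n) \sum_(j < n | i != j)
      (mean P (fun t => Y i t * Y j t) - mean P (Y i) * mean P (Y j)))
  + \sum_(k < n) mean P (Y k) ^+ 2 = S2 - sigma ^+ 2.
Proof.
have muE : mu = \sum_i mean P (Y i).
  by have [_ <-] := mean_sum (fun (k : 'I_n) (_ : true) => fY k).
have -> : sigma ^+ 2 =
    \sum_i \sum_j
      (mean P (fun t => Y i t * Y j t) - mean P (Y i) * mean P (Y j)).
  have -> : sigma ^+ 2 = mean P (fun t => W t ^+ 2) - mu ^+ 2.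
    by rewrite W2E addrK.
  rewrite mean_sqr_sumE muE expr2 mulr_suml -sumrB; apply: eq_bigr => i _.
  by rewrite mulr_sumr -sumrB.
rewrite -sumrN -big_split /S2 -sumrB; apply: eq_bigr => i _ /=.
rewrite [X in _ = _ - X](bigD1 i)//=.
under [in LHS]eq_bigl do rewrite eq_sym.
by rewrite !expr2; ring.
Qed.

Section test_function.
Variables (g dg : R -> R) (L M : R).
Hypothesis dgP : forall x : R, is_derive x 1 g (dg x).
Hypothesis dg_le : forall x, `|dg x| <= L.
Hypothesis dg_lip : forall x y, `|dg x - dg y| <= M * `|x - y|.

Let g_lip := is_derive1_lipschitz dgP dg_le.

Let mg : measurable_fun setT g.
Proof. exact: continuous_measurable_fun (lipschitz_continuous g_lip). Qed.

Let mdg : measurable_fun setT dg.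
Proof. exact: continuous_measurable_fun (lipschitz_continuous dg_lip). Qed.

Let fg : finite_mean P (fun t => g (W t)).
Proof. exact: (finite_mean_growth mg (lipschitz_growth g_lip) fW). Qed.

Lemma finite_mean_slope : finite_mean P (fun t => dg (W t)).
Proof. exact: (finite_mean_growth mdg (lipschitz_growth dg_lip) fW). Qed.

Let fWg : finite_mean P (fun t => W t * g (W t)).
Proof.
apply: (finite_mean_le _ _ (finite_meanD (finite_meanZ `|g 0|
  (finite_mean_abs fW)) (finite_meanZ L W2))) => [|t].
  by apply: measurable_funM => //; exact: measurableT_comp.
rewrite normrM -[W t ^+ 2]real_normK ?num_real//.
have := ler_wpM2l (normr_ge0 (W t)) (lipschitz_growth g_lip (W t)); lra.
Qed.

Lemma finite_mean_centered : finite_mean P (fun t => (W t - mu) * g (W t)).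
Proof.
have -> : (fun t => (W t - mu) * g (W t)) =
    (fun t => W t * g (W t) - mu * g (W t)) by apply/funext => t; ring.
exact: finite_meanB fWg (finite_meanZ _ fg).
Qed.

Let mean_centered : mean P (fun t => (W t - mu) * g (W t)) =
  mean P (fun t => W t * g (W t)) - mu * mean P (fun t => g (W t)).
Proof.
have -> : (fun t => (W t - mu) * g (W t)) =
    (fun t => W t * g (W t) - mu * g (W t)) by apply/funext => t; ring.
by rewrite (meanB fWg (finite_meanZ _ fg)) (meanZ _ fg).
Qed.

(** Both [L * x + g x] and [L * x - g x] are nondecreasing.  The linear part
costs [L] times the discrepancy of the identity, which is
[S2 - sigma ^+ 2] exactly. *)
Lemma na_discrepancy_le :
  `|mean P (fun t => (W t - mu) * g (W t)) - S2 * mean P (fun t => dg (W t))|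
  <= M / 2 * S3 + L * (S2 - sigma ^+ 2).
Proof.
rewrite mean_centered.
have bnd s : s = 1 \/ s = - 1 -> s * (mean P (fun t => W t * g (W t))
    - mu * mean P (fun t => g (W t)) - S2 * mean P (fun t => dg (W t)))
  <= M / 2 * S3 + L * (S2 - sigma ^+ 2).
  move=> s1; have ns : `|s| = 1 by case: s1 => ->; rewrite ?normrN normr1.
  have sdg x : `|s * dg x| <= L by rewrite normrM ns mul1r.
  have dG (x : R) :
      is_derive x 1 (fun x => L * x + s * g x) (L + s * dg x).
    by apply: is_derive1_eq; rewrite /GRing.scale/=; ring.
  have dG0 x : 0 <= L + s * dg x by have := sdg x; rewrite ler_norml; lra.
  have dG2 x : L + s * dg x <= 2 * L by have := sdg x; rewrite ler_norml; lra.
  have dGM x y : `|L + s * dg x - (L + s * dg y)| <= M * `|x - y|.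
    have -> : L + s * dg x - (L + s * dg y) = s * (dg x - dg y) by ring.
    by rewrite normrM ns mul1r.
  have := mean_na_sum_le dG dG0 dG2 dGM.
  have -> : (fun t =>
        (\sum_i Y i t) * (L * (\sum_i Y i t) + s * g (\sum_i Y i t))) =
      (fun t => L * W t ^+ 2 + s * (W t * g (W t))).
    by apply/funext => t; rewrite -/(W t); ring.
  rewrite (meanD (finite_meanZ _ W2) (finite_meanZ _ fWg)).
  rewrite (meanZ _ W2) (meanZ _ fWg) W2E.
  rewrite (meanD (finite_meanZ _ fW) (finite_meanZ _ fg)).
  rewrite (meanZ _ fW) (meanZ _ fg).
  rewrite (meanD (finite_mean_cst _ _) (finite_meanZ _ finite_mean_slope)).
  rewrite mean_cst (meanZ _ finite_mean_slope) -/mu -/S2 -/S3 -/(W _); lra.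
rewrite ler_norml lerNl -mulN1r -[X in _ && (X <= _)]mul1r.
by rewrite !bnd//; [left|right].
Qed.

Lemma mean_centered_le :
  `|mean P (fun t => (W t - mu) * g (W t))| <= L * sigma ^+ 2.
Proof.
have f0 : finite_mean P (fun t => W t - mu).
  exact: finite_meanB fW (finite_mean_cst _ _).
have f1 := finite_mean_centered.
have f2 : finite_mean P (fun t => (W t - mu) ^+ 2).
  have -> : (fun t => (W t - mu) ^+ 2) =
      (fun t => W t ^+ 2 - (2 * mu) * W t + mu ^+ 2).
    by apply/funext => t; ring.
  apply: finite_meanD (finite_mean_cst _ _).
  exact: finite_meanB W2 (finite_meanZ _ fW).
have -> : mean P (fun t => (W t - mu) * g (W t)) =
    mean P (fun t => (W t - mu) * g (W t) - g mu * (W t - mu)).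
  rewrite (meanB f1 (finite_meanZ _ f0)) (meanZ _ f0).
  by rewrite (meanB fW (finite_mean_cst _ _)) mean_cst -/mu subrr mulr0 subr0.
rewrite sigmaE -(meanZ _ f2).
apply: mean_abs_le => [||t].
- exact: finite_meanB f1 (finite_meanZ _ f0).
- exact: finite_meanZ.
have -> : (W t - mu) * g (W t) - g mu * (W t - mu) =
  (W t - mu) * (g (W t) - g mu) by ring.
rewrite normrM -[(W t - mu) ^+ 2]real_normK ?num_real//.
by rewrite expr2 mulrCA ler_wpM2l.
Qed.

End test_function.

(** The discrepancy compares [(W - mu) * g W] with [S2] times the slope of [g],
while Stein's equation asks for [sigma ^+ 2] times it.  Dividing by [S2] and
correcting the factor [sigma ^+ 2 / S2] costs the second half of the last
term, by [mean_centered_le]. *)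
Lemma na_normal_approx (h : R -> R) :
  (forall x y, `|h x - h y| <= `|x - y|) ->
  `|mean P (fun t => h (sigma^-1 * (W t - mu))) - normal_mean h| <=
  S3 / (sigma * S2) + 2 * Num.sqrt (2 / pi) * sigma ^- 2 * (S2 - sigma ^+ 2).
Proof.
move=> lip_h; set K := Num.sqrt (2 / pi).
have s0 : sigma != 0 by rewrite gt_eqF.
pose z w : R := sigma^-1 * (w - mu).
pose g w := stein h (z w).
pose dg w := sigma^-1 * steind h (z w).
have dgP (w : R) : is_derive w 1 g (dg w).
  have dz : is_derive w 1 z sigma^-1.
    by rewrite /z; apply: is_derive1_eq; rewrite /GRing.scale/=; ring.
  have ds : is_derive (z w) 1 (stein h) (steind h (z w)).
    exact: is_derive_stein.
  have H : is_derive w 1 (stein h \o z) (steind h (z w) * sigma^-1).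
    exact: is_derive1_comp.
  by apply: (is_derive1_eq H); rewrite mulrC.
have dg_le w : `|dg w| <= K / sigma.
  rewrite normrM normfV (gtr0_norm sigma_gt0) mulrC ler_pM2r ?invr_gt0//.
  exact: steind_le.
have dg_lip x y : `|dg x - dg y| <= (2 / sigma ^+ 2) * `|x - y|.
  rewrite /dg -mulrBr normrM normfV (gtr0_norm sigma_gt0).
  apply: (le_trans (ler_wpM2l _ (steind_lipschitz lip_h _ _))).
    by rewrite invr_ge0 ltW.
  have -> : z x - z y = sigma^-1 * (x - y) by rewrite /z; ring.
  rewrite normrM normfV (gtr0_norm sigma_gt0) le_eqVlt; apply/orP; left.
  by apply/eqP; field.
have disc := na_discrepancy_le dgP dg_le dg_lip.
have cent := mean_centered_le dgP dg_le.
move: disc cent; set A := mean P (fun t => (W t - mu) * g (W t)).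
set D := mean P (fun t => dg (W t)) => disc cent.
have -> : mean P (fun t => h (sigma^-1 * (W t - mu))) - normal_mean h =
  sigma * D - sigma^-1 * A.
  have f1 := finite_meanZ sigma (finite_mean_slope dg_lip).
  have f2 := finite_meanZ sigma^-1 (finite_mean_centered dgP dg_le).
  have -> : (fun t => h (sigma^-1 * (W t - mu))) = (fun t => sigma * dg (W t)
      - sigma^-1 * ((W t - mu) * g (W t)) + normal_mean h).
    apply/funext => t; rewrite /dg mulrA divff// mul1r mulrA -/(z (W t)).
    by rewrite /g /steind; ring.
  rewrite (meanD (finite_meanB f1 f2) (finite_mean_cst _ _)) (meanB f1 f2).
  rewrite (meanZ _ (finite_mean_slope dg_lip)).
  by rewrite (meanZ _ (finite_mean_centered dgP dg_le)) mean_cst addrK.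
have S2_ge := na_variance_le.
have S20 : 0 < S2 by rewrite (lt_le_trans _ S2_ge)// exprn_gt0.
have -> : sigma * D - sigma^-1 * A = - (sigma / S2) * (A - S2 * D)
   - (S2 - sigma ^+ 2) / (sigma * S2) * A.
  by field; rewrite s0 gt_eqF.
have a0 : 0 <= S2 - sigma ^+ 2 by rewrite subr_ge0.
have K0 : 0 <= K by exact: sqrtr_ge0.
have b1 : `|- (sigma / S2) * (A - S2 * D)| <=
    S3 / (sigma * S2) + K * ((S2 - sigma ^+ 2) / S2).
  have q0 : 0 <= sigma / S2 by rewrite ltW// divr_gt0.
  rewrite mulNr normrN normrM (ger0_norm q0).
  apply: (le_trans (ler_wpM2l q0 disc)).
  by rewrite le_eqVlt; apply/orP; left; apply/eqP; field; rewrite s0 gt_eqF.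
have b2 : `|(S2 - sigma ^+ 2) / (sigma * S2) * A| <=
    K * ((S2 - sigma ^+ 2) / S2).
  have q0 : 0 <= (S2 - sigma ^+ 2) / (sigma * S2).
    by rewrite divr_ge0// ltW// mulr_gt0.
  rewrite normrM (ger0_norm q0); apply: (le_trans (ler_wpM2l q0 cent)).
  by rewrite le_eqVlt; apply/orP; left; apply/eqP; field; rewrite s0 gt_eqF.
have b3 : (S2 - sigma ^+ 2) / S2 <= sigma ^- 2 * (S2 - sigma ^+ 2).
  by rewrite mulrC ler_wpM2r// lef_pV2 ?posrE ?exprn_gt0.
have := ler_wpM2l K0 b3; move: b1 b2 => b1 b2 b3'.
by apply: (le_trans (ler_normB _ _)); lra.
Qed.

End negative_association.

(** * Wasserstein distance to the normal law *)

Theorem theorem6 (R : realType)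
    (d : measure_display) (T : measurableType d) (P : probability T R)
    (d' : measure_display) (T' : measurableType d') (P' : probability T' R)
    (n : nat) (Y : 'I_n -> {RV P >-> R}) (Z : {RV P' >-> R}) (sigma : R)
    (Y_ge0 : forall i t, 0 <= Y i t)
    (Y_int : forall i t, Y i t \is a Num.int)
    (Y_NA : negatively_associated P Y)
    (Z_normal : forall B : set R, measurable B ->
       distribution P' Z B = normal_prob 0 1 B) :
  let W t := \sum_(i < n) Y i t in
  0 < sigma ->
  'V_P[W] = (sigma ^+ 2)%:E ->
  (wasserstein P P' (fun t => sigma^-1 * (W t - fine 'E_P[W]))%R Z <=
     (\sum_(k < n) 'E_P[fun t => (Y k t ^+ 3)%R])
       / (sigma%:E * \sum_(k < n) 'E_P[fun t => (Y k t ^+ 2)%R])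
     + (Num.sqrt (8 / pi) * sigma ^- 2)%:E
       * (- (\sum_(i < n) \sum_(j < n | i != j) covariance P (Y i) (Y j))
          + \sum_(k < n) 'E_P[Y k] ^+ 2))%E.
Proof.
move=> W sigma_gt0 varW.
have mY i : measurable_fun setT (Y i) by exact: measurable_funPT.
have mW : measurable_fun setT W by exact: measurable_sum.
have Y_nat i t : exists N : nat, Y i t = N%:R.
  by apply/natrP; rewrite natrEint Y_int Y_ge0.
pose m := fine 'E_P[W].
have varE : ('E_P[fun t => ((W t - m) ^+ 2)%R] = (sigma ^+ 2)%:E)%E.
  by rewrite -varW /variance covariance.unlock; congr (expectation P _).
have V2 : finite_mean P (fun t => (W t - m) ^+ 2).
  apply: finite_mean_ge0 => [|t|]; last by rewrite varE ltry.
  - by apply: measurable_funX; exact: measurable_funB.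
  - exact: sqr_ge0.
have W2 : finite_mean P (fun t => W t ^+ 2).
  apply: (finite_mean_le _ _ (finite_meanD (finite_meanZ 2 V2)
    (finite_mean_cst P (2 * m ^+ 2)))) => [|t]; first exact: measurable_funX.
  by rewrite ger0_norm ?sqr_ge0//; have := sqr_ge0 (W t - 2 * m); lra.
have fW : finite_mean P W by exact: finite_mean_sqr.
have mE : m = mean P W by rewrite /m expectation_mean.
have sigmaE : sigma ^+ 2 = mean P (fun t => (W t - mean P W) ^+ 2).
  by rewrite -mE; apply/EFin_inj; rewrite -varE expectation_mean.
have fYY := finite_mean_mul mY Y_nat W2.
have YW i t : 0 <= Y i t <= W t.
  by rewrite Y_ge0/= /W (bigD1 i)//= lerDl sumr_ge0.
have fY i : finite_mean P (Y i).
  apply: finite_mean_le (mY i) _ fW => t.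
  by have /andP[Y0 ?] := YW i t; rewrite ger0_norm.
have fY2 i : finite_mean P (fun t => Y i t ^+ 2) by exact: fYY.
have S2E : (\sum_(k < n) 'E_P[fun t => (Y k t ^+ 2)%R] =
    (\sum_(k < n) mean P (fun t => Y k t ^+ 2))%:E)%E.
  by rewrite -sumEFin; apply: eq_bigr => k _; exact: expectation_mean.
have covE : (- (\sum_(i < n) \sum_(j < n | i != j) covariance P (Y i) (Y j))
    + \sum_(k < n) 'E_P[Y k] ^+ 2 =
    (\sum_(k < n) mean P (fun t => Y k t ^+ 2) - sigma ^+ 2)%:E)%E.
  rewrite -(covariance_defectE mY Y_nat W2 sigmaE) EFinD EFinN -!sumEFin.
  congr (- _ + _)%E; apply: eq_bigr => i _.
    rewrite -sumEFin; apply: eq_bigr => j _.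
    have l1 k : (Y k : T -> R) \in Lfun P 1.
      by apply/Lfun1_integrable; exact: fY.
    have l2 : ((Y i : T -> R) * Y j)%R \in Lfun P 1.
      by apply/Lfun1_integrable; exact: fYY.
    rewrite covarianceE// (expectation_mean (fY i)) (expectation_mean (fY j)).
    by rewrite (expectation_mean (fYY i j : finite_mean P (Y i \* Y j))) EFinB.
  by rewrite expectation_mean// -EFin_expe.
rewrite covE S2E.
have S2_gt0 := sum_sqr_mean_gt0 mY Y_nat W2 sigma_gt0 sigmaE.
(* An infinite third moment makes the right-hand side infinite. *)
have [S3_inf|S3_fin] :=
  eqVneq (\sum_(k < n) 'E_P[fun t => (Y k t ^+ 3)%R])%E +oo%E.
  rewrite S3_inf -!EFinM inver mulf_eq0 !gt_eqF//=.
  rewrite gt0_mulye ?lte_fin ?invr_gt0 ?mulr_gt0//.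
  by rewrite addye// leey.
have Y3 i : finite_mean P (fun t => Y i t ^+ 3).
  apply: finite_mean_ge0 => [|t|]; [exact: measurable_funX|exact: exprn_ge0|].
  have : (\sum_(k < n) 'E_P[fun t => (Y k t ^+ 3)%R] < +oo)%E by rewrite ltey.
  apply: le_lt_trans; rewrite (bigD1 i)//= leeDl// sume_ge0// => k _.
  by apply: expectation_ge0 => t; exact: exprn_ge0.
have S3E : (\sum_(k < n) 'E_P[fun t => (Y k t ^+ 3)%R] =
    (\sum_(k < n) mean P (fun t => Y k t ^+ 3))%:E)%E.
  by rewrite -sumEFin; apply: eq_bigr => k _; exact: expectation_mean.
rewrite S3E /wasserstein -/m mE.
apply: ge_ereal_sup => _ [h lip_h <-].
have mh : measurable_fun setT h.
  apply: continuous_measurable_fun.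
  by apply: (@lipschitz_continuous _ h 1) => x y; rewrite mul1r; exact: lip_h.
have EZ : ('E_P'[h \o Z] = (normal_mean h)%:E)%E.
  rewrite (expectation_normal Z_normal mh) /normal_mean /Rintegral fineK//.
  by apply: integrable_fin_num => //; exact: integrable_lipschitz_phi.
have fh : finite_mean P (h \o (fun t => sigma^-1 * (W t - mean P W))).
  apply: (finite_mean_growth mh (@lipschitz_growth _ h 1 _)).
    by move=> x y; rewrite mul1r.
  by apply: finite_meanZ; apply: finite_meanB fW (finite_mean_cst _ _).
have sqrt8 : Num.sqrt (8 / pi) = 2 * Num.sqrt (2 / pi) :> R.
  have -> : 8 / pi = 2 ^+ 2 * (2 / pi) :> R.
    by rewrite mulrA; congr (_ / _); ring.
  by rewrite sqrtrM ?sqr_ge0// sqrtr_sqr ger0_norm.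
rewrite EZ (expectation_mean fh) -EFinB abse_EFin.
rewrite -EFinM inver mulf_eq0 !gt_eqF//= -!EFinM -EFinD lee_fin sqrt8.
exact: (na_normal_approx mY Y_NA Y_nat Y3 W2 sigma_gt0 sigmaE lip_h).
Qed.
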